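(* Let $q\geq 3$ be a prime power and let $\mathcal K$ be a set of $q^2+2q+1$ points in $\mathrm{PG}(4,q)$. Then $\mathcal K$ is a ruled cubic surface if and only if every 3-space (hyperplane) $\Pi$ of $\mathrm{PG}(4,q)$ meets $\mathcal K$ in either one line, two lines, three lines, a line and a non-degenerate conic, or a twisted cubic (that is, the point set $\Pi\cap\mathcal K$ is equal to a set of one of these five kinds).
   Context: $\mathrm{PG}(4,q)$ is the 4-dimensional projective space over $\mathbb F_q$; 3-spaces are its hyperplanes. Lines, conics and twisted cubics are regarded as sets of points. ''Two lines'' and ''three lines'' mean the union of two, respectively three, distinct lines; ''a line and a non-degenerate conic'' means the union of a line and a non-degenerate conic of some plane. A twisted cubic of a 3-space $\mathrm{PG}(3,q)$ is a set of $q+1$ points projectively equivalent to $\{(1,t,t^2,t^3)\,|\,t\in\mathbb F_q\}\cup\{(0,0,0,1)\}$. Ruled cubic surface: In $\mathrm{PG}(4,q)$, let $\ell$ be a line and let $\mathcal C$ be a non-degenerate conic in a plane $\pi$ with $\ell\cap\pi=\emptyset$. Up to a change of projective coordinates, $\ell=\{(1,\theta,0,0,0)\,|\,\theta\in\mathbb F_q\cup\{\infty\}\}$ and $\mathcal C=\{(0,0,1,\phi,\phi^2)\,|\,\phi\in\mathbb F_q\cup\{\infty\}\}$ (where $\infty$ gives $(0,1,0,0,0)$ and $(0,0,0,0,1)$ respectively), so $\theta,\phi$ are non-homogeneous coordinates of $\ell,\mathcal C$. Let $\sigma\in\mathrm{PGL}(2,q)$ be a projectivity mapping $(1,\theta)$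 to $(1,\phi)$. The set of points on the $q+1$ lines joining each point of $\ell$ to the corresponding point of $\mathcal C$ under $\sigma$ is called a scroll ruling a line and a conic according to a projectivity; such a scroll is a ruled cubic surface, and a ruled cubic surface of $\mathrm{PG}(4,q)$ means a point set of this form. *)

(* Defs.v *)
From HB Require Import structures.
From mathcomp Require Import all_boot all_order all_algebra.

Set Implicit Arguments.
Unset Strict Implicit.
Unset Printing Implicit Defensive.

Import GRing.Theory.
Local Open Scope ring_scope.

Section FiniteVspace.
Import VectorInternalTheory.
Variables (F : finFieldType) (n : nat).
HB.instance Definition _ := [Countable of {vspace 'rV[F]_n} by <:].
HB.instance Definition _ := [Finite of {vspace 'rV[F]_n} by <:].
End FiniteVspace.

Definition PG (F : finFieldType) (n : nat) : finType :=
  {U : {vspace 'rV[F]_n.+1} | \dim U == 1}.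

Section ProjectiveGeometry.
Variables (F : finFieldType) (n : nat).
Implicit Types (U P H : {vspace 'rV[F]_n.+1}) (X : {set PG F n}).

Definition points_of U : {set PG F n} := [set p | (val p <= U)%VS].

Definition is_line X : Prop := exists2 U, \dim U = 2 & X = points_of U.

(* The form need not be symmetric: in characteristic 2 symmetric matrices do
   not give all quadratic forms. *)
Definition qform (A : 'M[F]_n.+1) (v : 'rV[F]_n.+1) : F :=
  (v *m A *m v^T) 0 0.

(* No singular vector of the form is in the radical of its polar form; this is
   nonsingularity in every characteristic, F being perfect. *)
Definition nondegenerate_on P (A : 'M[F]_n.+1) : Prop :=
  forall v, v \in P -> qform A v = 0 ->
    (forall w, w \in P -> qform A (v + w) - qform A v - qform A w = 0) ->
    v = 0.

Definition nondegenerate_conic P X : Prop :=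
  \dim P = 3 /\
  exists2 A : 'M[F]_n.+1, nondegenerate_on P A &
    X = [set p in points_of P |
          [forall v : 'rV[F]_n.+1, (v \in val p) ==> (qform A v == 0)]].

(* The points spanned by f (s, t), for homogeneous parameters (s, t) != 0;
   the parameter (1, theta) has non-homogeneous coordinate theta, and (0, 1)
   is infinity. *)
Definition param (f : 'rV[F]_2 -> 'rV[F]_n.+1) : {set PG F n} :=
  [set p | [exists u : 'rV[F]_2, (u != 0) && (val p == <[f u]>%VS)]].

End ProjectiveGeometry.

(* (s, t) |-> (s^d, s^(d-1) t, ..., t^d) *)
Definition veronese (F : finFieldType) (d : nat) (u : 'rV[F]_2) :
    'rV[F]_d.+1 :=
  \row_(i < d.+1) (u 0 0 ^+ (d - i) * u 0 1 ^+ i).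

(* The rows of E are a frame of the 3-space containing the curve. *)
Definition twisted_cubic (F : finFieldType) (n : nat) (X : {set PG F n}) :
    Prop :=
  exists2 E : 'M[F]_(4, n.+1), row_free E &
    X = param (fun u => veronese 3 u *m E).

Section PG4.
Variable F : finFieldType.
Implicit Types (u : 'rV[F]_2) (X : {set PG F 4}).

(* (s, t, 0, 0, 0) and (0, 0, s^2, s t, t^2) *)
Definition line_vec u : 'rV[F]_5 := row_mx u (0 : 'rV[F]_3).
Definition conic_vec u : 'rV[F]_5 := row_mx (0 : 'rV[F]_2) (veronese 2 u).

Definition scroll (g : 'M[F]_5) (sigma : 'M[F]_2) : {set PG F 4} :=
  [set p : PG F 4 | [exists u : 'rV[F]_2, (u != 0) &&
    (val p <= <[line_vec u *m g]> + <[conic_vec (u *m sigma) *m g]>)%VS]].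

(* g is the change of projective coordinates, and sigma represents the
   projectivity in the coordinates theta of l and phi of c. *)
Definition ruled_cubic_surface X : Prop :=
  exists (l c : {set PG F 4}) (P : {vspace 'rV[F]_5}),
    [/\ is_line l, nondegenerate_conic P c, l :&: points_of P = set0 &
      exists (g : 'M[F]_5) (sigma : 'M[F]_2),
        [/\ g \in unitmx, sigma \in unitmx,
            l = param (fun u => line_vec u *m g),
            c = param (fun u => conic_vec u *m g) &
            X = scroll g sigma]].

Definition two_lines X : Prop :=
  exists l1 l2 : {set PG F 4},
    [/\ is_line l1, is_line l2, l1 <> l2 & X = l1 :|: l2].

Definition three_lines X : Prop :=
  exists l1 l2 l3 : {set PG F 4},
    [/\ is_line l1, is_line l2 & is_line l3] /\
    [/\ l1 <> l2, l1 <> l3, l2 <> l3 & X = l1 :|: l2 :|: l3].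

Definition line_and_conic X : Prop :=
  exists (l c : {set PG F 4}) (P : {vspace 'rV[F]_5}),
    [/\ is_line l, nondegenerate_conic P c & X = l :|: c].

End PG4.

(* Main.v *)
Require Import Defs.
From mathcomp Require Import all_boot all_order all_algebra.
From mathcomp Require Import zify ring.

Set Implicit Arguments.
Unset Strict Implicit.
Unset Printing Implicit Defensive.

Import GRing.Theory.

(** Let q be the order of the field. The proof rests on counting points of K in the
hyperplanes through a plane, and then on comparing two conics contained in K.

Sections of a scroll ([sections_of_ruled]). Absorbing sigma into the frame, the points
of a scroll are (a u, b u^2), where u = (s, t) is a parameter, u^2 stands for
(s^2, s t, t^2), and a, b are scalars. A hyperplane cuts the ruling over u in the points
with a L(u) + b Q(u) = 0, for a linear form L and a quadratic form Q that are not both 0.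
If L = 0, the section is the directrix and the rulings over the at most two zeros of Q.
If L is not 0 and divides Q, it is the ruling over the zero of L and a conic. Otherwise
L and Q have no common zero and (Q(u) u, - L(u) u^2) parametrises a twisted cubic.

Conversely, let all hyperplane sections of K be of the five kinds. Conics and twisted
cubics have a rational parametrisation of degree d = 2 or 3, so they have q + 1 points,
at most d of them in a subspace not containing the curve ([card_rnc], [rnc_cap_le]).
Hence a section has q + 1 points, or at least 2q ([section_card]), and the lines
contained in it are the evident ones ([sectionP]). The q + 1 hyperplanes through a
plane P partition the points off P, so that the numbers by which their sections exceed
q + 1 add up to q |P :&: K| ([excess_sum]). This has the following consequences.

- K contains a line, and not all the lines of K are pairwise skew ([exists_kline],
  [not_skew]). If they were, no hyperplane would contain three of them; some hyperplane
  section would be a line and a conic, and every hyperplane through the plane of that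
  conic would contain a further line of K. Two of these lines span a hyperplane, which
  the third meets in a point of one of the two.

- If m and n are lines of K that meet, then q further lines of K meet m or n, and
  these q + 2 lines cover K ([card_transversals], [pair_cover]). Either all of them meet
  m or all of them meet n ([transversals_same_side]), so K consists of a line m and q + 1
  lines meeting it ([exists_directrix]), which are the generators. They are pairwise
  disjoint ([gen_disjoint]), because a hyperplane meeting m in a point that is on no
  generator would have q + 2 points of K.

- A hyperplane containing a generator, but not m, meets K in this generator and a conic
  that has a point on each generator, in a plane disjoint from m ([conic_section]).

It remains to see that the bijection between m and such a conic given by the generators
is a projectivity ([correspondence]). A second conic of this kind, in another plane but
sharing a point with the first plane and the first conic, describes the bijection by
quadratic forms on the conic. These have a common zero at the shared point; dividing by the
corresponding linear factor makes them linear. *)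

(** * Points and subspaces *)

Section Incidence.
Variables (F : finFieldType) (n : nat).
Local Notation V := 'rV[F]_n.+1.
Local Notation vs := {vspace V}.
Implicit Types (U L P W : vs) (p r : PG F n) (v w : V).

Lemma dim_ambient : \dim {:V} = n.+1.
Proof. by rewrite dimvf dim_matrix; exact: mul1n. Qed.

Lemma PG_vec p : exists2 v, v != 0%R & val p = <[v]>%VS.
Proof.
have dp : \dim (val p) = 1 by apply/eqP; exact: (valP p).
have v0 : vpick (val p) != 0%R by rewrite vpick0 -dimv_eq0 dp.
exists (vpick (val p)) => //; apply/esym/eqP.
by rewrite eqEdim -memvE memv_pick dp dim_vline v0.
Qed.

Lemma vec_PG v : v != 0%R -> exists p : PG F n, val p = <[v]>%VS.
Proof.
move=> v0; have dv : \dim <[v]>%VS == 1 by rewrite dim_vline v0.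
by exists (Sub <[v]>%VS dv : PG F n); rewrite SubK.
Qed.

Lemma in_points p U : (p \in points_of U) = (val p <= U)%VS.
Proof. by rewrite inE. Qed.

Lemma dim_point p : \dim (val p) = 1.
Proof. exact/eqP/(valP p). Qed.

Lemma points_ofS U W : (U <= W)%VS -> points_of U \subset points_of W.
Proof. by move=> UW; apply/subsetP => p; rewrite !in_points => /subv_trans; apply. Qed.

Lemma points_ofI U W : points_of U :&: points_of W = points_of (U :&: W)%VS.
Proof. by apply/setP => p; rewrite inE !in_points subv_cap. Qed.

Lemma points_of_subset U W : (points_of U \subset points_of W) = (U <= W)%VS.
Proof.
apply/idP/idP=> [/subsetP UW|]; last exact: points_ofS.
apply/subvP => v vU; have [->|/vec_PG[p pv]] := eqVneq v 0%R; first exact: mem0v.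
by have := UW p; rewrite !in_points pv -!memvE => ->.
Qed.

Lemma points_of_inj : injective (@points_of F n).
Proof.
move=> U W UW; apply/eqP.
by rewrite eqEsubv -!points_of_subset UW !subxx.
Qed.

Lemma points_of0 : points_of (0%VS : vs) = set0.
Proof.
apply/setP => p; rewrite in_points inE.
by apply/negP => /dimvS; rewrite dim_point dimv0.
Qed.

Lemma points_of_point p : points_of (val p) = [set p].
Proof.
apply/setP => r; rewrite in_points inE; apply/idP/eqP => [rp|->//].
by apply: val_inj; apply/eqP; rewrite eqEdim rp !dim_point.
Qed.

Lemma dim1_point U : \dim U = 1 -> exists p : PG F n, U = val p.
Proof. by move/eqP => dU; exists (Sub U dU : PG F n); rewrite SubK. Qed.

Lemma card_points_dim1 U : \dim U = 1 -> #|points_of U| = 1.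
Proof. by move=> /dim1_point[p ->]; rewrite points_of_point cards1. Qed.

Lemma card_points_le1 U : \dim U <= 1 -> #|points_of U| <= 1.
Proof.
rewrite leq_eqVlt ltnS leqn0 => /orP[/eqP/card_points_dim1-> //|].
by rewrite dimv_eq0 => /eqP->; rewrite points_of0 cards0.
Qed.

Lemma point_exists U : 0 < \dim U -> exists p, p \in points_of U.
Proof.
rewrite lt0n dimv_eq0 -vpick0 => /vec_PG[p pU]; exists p.
by rewrite in_points pU -memvE memv_pick.
Qed.

Lemma dim_add_point U p : p \notin points_of U -> \dim (U + val p)%VS = (\dim U).+1.
Proof.
move=> pU; have := dimv_sum_cap U (val p); rewrite dim_point addn1.
suff -> : (U :&: val p)%VS = 0%VS by rewrite dimv0 addn0.
apply/eqP; rewrite -dimv_eq0; case E: (\dim _) => [//|k].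
have [r] : exists r, r \in points_of (U :&: val p)%VS by apply: point_exists; rewrite E.
rewrite -points_ofI points_of_point !inE => /andP[rU /eqP rp].
by move: pU; rewrite -rp inE rU.
Qed.

Lemma line_cap_le1 L W : \dim L = 2 -> ~~ (L <= W)%VS ->
  #|points_of L :&: points_of W| <= 1.
Proof.
move=> dL LW; rewrite points_ofI; apply: card_points_le1.
have := dimvS (capvSl L W); rewrite dL leq_eqVlt => /orP[/eqP d|//].
case/negP: LW; apply/capv_idPl/eqP.
by rewrite eqEdim capvSl d dL.
Qed.

Lemma line_through L W p r : \dim L = 2 -> p != r ->
  p \in points_of L -> r \in points_of L ->
  p \in points_of W -> r \in points_of W -> (L <= W)%VS.
Proof.
move=> dL pr pL rL pW rW; apply: contraT => /(line_cap_le1 dL).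
have /subset_leq_card : [set p; r] \subset points_of L :&: points_of W.
  by apply/subsetP => x /set2P[]->; rewrite inE; apply/andP.
by rewrite cards2 pr => /leq_trans h /h.
Qed.

Lemma line_neq_sub L L' : \dim L = 2 -> \dim L' = 2 -> L != L' -> ~~ (L <= L')%VS.
Proof. by move=> dL dL'; apply: contra => LL'; rewrite eqEdim LL' dL dL'. Qed.

Lemma line_cap_line L L' : \dim L = 2 -> \dim L' = 2 -> L != L' ->
  #|points_of L :&: points_of L'| <= 1.
Proof. by move=> dL dL' /(line_neq_sub dL dL'); exact: line_cap_le1. Qed.

Lemma dim_capv_in U W H : (U <= H)%VS -> (W <= H)%VS ->
  \dim U + \dim W <= \dim H + \dim (U :&: W)%VS.
Proof.
move=> UH WH; rewrite -dimv_sum_cap leq_add2r; apply: dimvS.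
by rewrite subv_add UH WH.
Qed.

Lemma cap_point_card L W H : \dim L = 2 -> (L <= H)%VS -> (W <= H)%VS ->
  \dim H = (\dim W).+1 -> ~~ (L <= W)%VS -> #|points_of L :&: points_of W| = 1.
Proof.
move=> dL LH WH dH LW; apply/eqP; rewrite eqn_leq line_cap_le1 //=.
have := dim_capv_in LH WH; rewrite dL dH points_ofI card_gt0 => d.
have /point_exists[p pI] : 0 < \dim (L :&: W)%VS by lia.
by apply/set0Pn; exists p.
Qed.

Lemma superspace_of_dim U d : \dim U <= d <= n.+1 -> exists2 W, (U <= W)%VS & \dim W = d.
Proof.
elim: d => [|d IHd] /andP[Ud dn].
  by exists U => //; apply/eqP; rewrite -leqn0.
move: Ud; rewrite leq_eqVlt => /orP[/eqP <-|Ud]; first by exists U.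
have [|W UW dW] := IHd; first by rewrite -ltnS Ud ltnW.
have : ~~ (fullv <= W)%VS.
  by apply/negP => /dimvS; rewrite dim_ambient dW leqNgt dn.
case/subvPn => v _ vW.
have [p pv] : exists p : PG F n, val p = <[v]>%VS.
  by apply: vec_PG; apply: contraNneq vW => ->; exact: mem0v.
exists (W + val p)%VS; first exact: subv_trans UW (addvSl _ _).
by rewrite dim_add_point ?dW // in_points pv -memvE.
Qed.

Lemma hyperplane_avoid U p : p \notin points_of U ->
  exists H, [/\ \dim H = n, (U <= H)%VS & p \notin points_of H].
Proof.
move=> pU; pose W := (U + val p)%VS.
exists (U + W^C)%VS; split; [|exact: addvSl|].
  have dW := dim_add_point pU; rewrite -/W in dW.
  have UW0 : (U :&: W^C = 0)%VS.
    apply/eqP; rewrite -subv0 -(capv_compl W); apply: capvS => //; exact: addvSl.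
  rewrite dimv_disjoint_sum // dimv_compl dW dim_ambient subSS.
  have := dimvS (subvf W); rewrite dW dim_ambient; lia.
have [v v0 pv] := PG_vec p; rewrite in_points pv -memvE; apply/negP.
case/memv_addP => u uU [w wW vE].
have : w \in (W :&: W^C)%VS.
  rewrite memv_cap wW andbT; have -> : w = (v - u)%R by rewrite vE addrC addKr.
  apply: memvB; last by apply: (subvP (addvSl U (val p))).
  by apply: (subvP (addvSr U (val p))); rewrite pv memv_line.
rewrite capv_compl memv0 => /eqP w0; move: pU.
by rewrite in_points pv -memvE vE w0 addr0 uU.
Qed.

End Incidence.

(** * Rational normal curves *)

Section RowSpaces.
Variables (F : finFieldType) (n : nat).
Local Notation V := 'rV[F]_n.+1.
Local Notation vs := {vspace V}.
Local Open Scope ring_scope.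

Definition rowvs k (E : 'M[F]_(k, n.+1)) : vs :=
  limg (linfun (mulmxr E : 'rV[F]_k -> V)).

Lemma rowvsP k (E : 'M[F]_(k, n.+1)) v :
  reflect (exists w, v = w *m E) (v \in rowvs E).
Proof.
apply: (iffP memv_imgP) => [[w _ ->]|[w ->]]; exists w; rewrite ?lfunE //=.
exact: memvf.
Qed.

Lemma mem_rowvs k (E : 'M[F]_(k, n.+1)) w : w *m E \in rowvs E.
Proof. by apply/rowvsP; exists w. Qed.

Lemma dim_rowvs k (E : 'M[F]_(k, n.+1)) : row_free E -> \dim (rowvs E) = k.
Proof.
move=> fE; rewrite limg_dim_eq; first by rewrite dimvf dim_matrix; exact: mul1n.
rewrite capfv; apply/eqP/lker0P => x y; rewrite !lfunE /=.
exact: row_free_inj.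
Qed.

Lemma rowvs_basis (U : vs) k : \dim U = k ->
  exists2 E : 'M[F]_(k, n.+1), row_free E & rowvs E = U.
Proof.
move=> <-; pose E : 'M[F]_(\dim U, n.+1) := \matrix_i (vbasis U)`_i.
have rE w : w *m E = \sum_i w 0 i *: (vbasis U)`_i.
  by rewrite mulmx_sum_row; apply: eq_bigr => i _; rewrite rowK.
exists E.
  apply/row_freeP/row_freeP/inj_row_free => w; rewrite rE => w0.
  have /freeP fr := basis_free (vbasisP U).
  by apply/rowP => i; rewrite mxE; apply: (fr (w 0)).
apply/vspaceP => v; apply/rowvsP/idP => [[w ->]|vU].
  rewrite rE; apply: rpred_sum => i _; apply: memvZ; apply: vbasis_mem.
  by rewrite mem_nth // size_tuple.
exists (\row_i coord (vbasis U) i v); rewrite rE [LHS](coord_vbasis vU).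
by apply: eq_bigr => i _; rewrite mxE.
Qed.

(** A vector off a row space is detected by a column of its cokernel. *)
Lemma linear_form_separating (U : vs) v : v \notin U ->
  exists phi : 'cV[F]_n.+1, (forall u, u \in U -> u *m phi = 0) /\ v *m phi != 0.
Proof.
have [E fE <-] := rowvs_basis (erefl (\dim U)) => vE.
have : ~~ (v <= E)%MS by apply: contra vE => /submxP[D ->]; exact: mem_rowvs.
rewrite submxE => /rV0Pn[j vj].
exists (col j (cokermx E)); split=> [u /rowvsP[w ->]|].
  by rewrite colE -mulmxA [E *m _]mulmxA mulmx_coker mul0mx mulmx0.
apply: contra vj => /eqP; rewrite colE mulmxA -colE => /matrixP/(_ 0 0).
by rewrite !mxE => ->.
Qed.

End RowSpaces.

Section Curves.
Variable F : finFieldType.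
Implicit Types (u : 'rV[F]_2) (s t c k : F) (o : option F).
Local Open Scope ring_scope.

Definition row2 (s t : F) : 'rV[F]_2 := \row_j (if j == 0 then s else t).

Lemma row2E (u : 'rV[F]_2) : u = row2 (u 0 0) (u 0 1).
Proof.
apply/rowP => j; rewrite mxE; case: ifP => [/eqP-> //|].
by case: j => [[|[|j]] jl] //= _; congr (u 0 _); apply: val_inj.
Qed.

(** The normalised representatives (1, t) and (0, 1) of the points of the
    projective line; [None] is the point at infinity. *)
Definition par (o : option F) : 'rV[F]_2 := if o is Some t then row2 1 t else row2 0 1.

Lemma par_repr u : u != 0 -> exists c o, c != 0 /\ u = c *: par o.
Proof.
rewrite [u]row2E; move: (u 0 0) (u 0 1) => s t u0.
have [s0|s0] := eqVneq s 0.
  exists t, None; split.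
    by apply: contraNneq u0 => ->; apply/eqP/rowP => j; rewrite !mxE s0 if_same.
  by apply/rowP => j; rewrite !mxE s0; case: ifP; rewrite ?mulr0 ?mulr1.
exists s, (Some (t / s)); split=> //.
by apply/rowP => j; rewrite !mxE; case: ifP; rewrite ?mulr1 // mulrCA divff ?mulr1.
Qed.

Lemma par_neq0 o : par o != 0.
Proof.
by apply/rV0Pn; case: o => [t|]; [exists 0|exists 1]; rewrite mxE /= oner_neq0.
Qed.

Lemma veroneseZ d c u : veronese d (c *: u) = c ^+ d *: veronese d u.
Proof.
apply/rowP => i; rewrite !mxE !exprMn mulrACA -exprD subnK //.
by rewrite -ltnS ltn_ord.
Qed.

Lemma veronese_par d t : veronese d (par (Some t)) = \row_i t ^+ i.
Proof. by apply/rowP => i; rewrite !mxE /= expr1n mul1r. Qed.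

Lemma veronese_inf d : veronese d (par None) = \row_i (i == ord_max)%:R.
Proof.
apply/rowP => i; rewrite !mxE /= expr1n mulr1 expr0n subn_eq0.
by congr (nat_of_bool _)%:R; rewrite -val_eqE /= eqn_leq leq_ord.
Qed.

Lemma veronese_par_neq0 d o : veronese d (par o) != 0.
Proof.
apply/rV0Pn; case: o => [t|].
  by exists 0; rewrite veronese_par mxE oner_neq0.
by exists ord_max; rewrite veronese_inf mxE eqxx oner_neq0.
Qed.

Lemma veronese_neq0 d u : u != 0 -> veronese d u != 0.
Proof.
case/par_repr=> c [o [c0 ->]].
by rewrite veroneseZ scaler_eq0 expf_eq0 (negPf c0) andbF /= veronese_par_neq0.
Qed.

Lemma veronese_par_inj d k o o' : (0 < d)%N ->
  veronese d (par o) = k *: veronese d (par o') -> o = o'.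
Proof.
move=> d0; have i1 : (1 < d.+1)%N by rewrite ltnS.
case: o o' => [t|] [t'|] //; rewrite ?veronese_par ?veronese_inf => /rowP E.
- move: (E 0) (E (Ordinal i1)); rewrite !mxE !expr0 mulr1 => <-.
  by rewrite !expr1 mul1r => ->.
- move: (E 0); rewrite !mxE expr0 -val_eqE /= eq_sym.
  by rewrite (gtn_eqF d0) mulr0 => /eqP; rewrite oner_eq0.
- move: (E 0) (E ord_max); rewrite !mxE -val_eqE /= eq_sym (gtn_eqF d0) expr0 mulr1.
  by move=> <-; rewrite eqxx mul0r => /eqP; rewrite oner_eq0.
Qed.

(** The point at infinity is a zero exactly when the leading coefficient vanishes,
    and then the affine polynomial has smaller degree. *)
Lemma binary_form_zeros d (c : 'cV[F]_d.+1) : c != 0 ->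
  (#|[set o | ((veronese d (par o) *m c) 0 0 == 0)%R]| <= d)%N.
Proof.
move=> c0; set A := [set o | _]; pose f := \poly_(i < d.+1) c (inord i) 0.
have fE t : (veronese d (par (Some t)) *m c) 0 0 = f.[t].
  rewrite mxE horner_poly; apply: eq_bigr => i _.
  by rewrite veronese_par mxE mulrC inord_val.
have infE : (veronese d (par None) *m c) 0 0 = c ord_max 0.
  rewrite mxE (bigD1 ord_max) //= veronese_inf mxE eqxx mul1r big1 ?addr0 // => i.
  by move=> /negPf ni; rewrite mxE ni mul0r.
have f0 : f != 0.
  case/cV0Pn: c0 => i ci; apply: contra_neq ci => /polyP/(_ i).
  by rewrite coef_poly ltn_ord inord_val coef0.
pose T := [set t | root f t].
have Tlt : (#|T| < size f)%N.
  rewrite cardE; apply: max_poly_roots => //; last exact: enum_uniq.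
  by apply/allP => t; rewrite mem_enum inE.
have sf : (size f <= d.+1)%N by exact: size_poly.
have [|nA] := boolP (None \in A).
  rewrite inE infE => /eqP cd.
  have sfd : (size f <= d)%N.
    apply/leq_sizeP => j; rewrite leq_eqVlt => /orP[/eqP <-|dj].
      by rewrite coef_poly ltnSn -[RHS]cd; congr (c _ _); apply: val_inj; rewrite /= inordK.
    by rewrite coef_poly ltnNge dj.
  have : A \subset None |: Some @: T.
    apply/subsetP => -[t|]; rewrite !inE ?fE //= => r.
    by apply/imsetP; exists t; rewrite ?inE.
  move=> /subset_leq_card/leq_trans; apply; rewrite cardsU1 card_imset; last by move=> ? ? [].
  by rewrite (leq_trans _ (leq_trans Tlt sfd)) // -addn1 addnC leq_add2l; case: (_ \notin _).
have : A \subset Some @: T.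
  apply/subsetP => -[t|]; last by rewrite (negPf nA).
  by rewrite inE fE => r; apply/imsetP; exists t; rewrite ?inE.
move=> /subset_leq_card/leq_trans; apply; rewrite card_imset; last by move=> ? ? [].
by rewrite -ltnS (leq_trans Tlt).
Qed.

End Curves.

Section RationalNormalCurves.
Variables (F : finFieldType) (n : nat).
Local Notation V := 'rV[F]_n.+1.
Local Notation vs := {vspace V}.
Local Open Scope ring_scope.

Definition rnc d (E : 'M[F]_(d.+1, n.+1)) : {set PG F n} :=
  param (fun u => veronese d u *m E).

Lemma eq_param (f h : 'rV[F]_2 -> V) : f =1 h -> param f = param h.
Proof.
by move=> fh; apply/setP => p; rewrite [LHS]inE [RHS]inE; apply: eq_existsb => u; rewrite fh.
Qed.

Lemma vline_scale c v : c != 0 -> <[c *: v]>%VS = <[v]>%VS :> vs.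
Proof.
move=> c0; apply/eqP; rewrite eqEsubv -!memvE memvZ ?memv_line //=.
by rewrite -[X in X \in _](scalerK c0) memvZ ?memv_line.
Qed.

Lemma mulmx_free_neq0 k (E : 'M[F]_(k, n.+1)) w : row_free E -> w != 0 -> w *m E != 0 :> 'rV_ _.
Proof.
move=> fE; apply: contra_neq => wE; apply: (row_free_inj fE).
by rewrite mul0mx wE.
Qed.

(** Homogeneity reduces the parameters to one representative of each point of the
    projective line, which makes the points of the curve easy to count. *)
Lemma rnc_repr d (E : 'M[F]_(d.+1, n.+1)) : row_free E ->
  exists f : option F -> PG F n,
    (forall o, val (f o) = <[veronese d (par o) *m E]>%VS) /\ rnc E = f @: setT.
Proof.
move=> fE.
have df o : \dim <[veronese d (par o) *m E]>%VS == 1%N.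
  by rewrite dim_vline mulmx_free_neq0 ?veronese_par_neq0.
pose f o : PG F n := Sub <[veronese d (par o) *m E]>%VS (df o).
have vf o : val (f o) = <[veronese d (par o) *m E]>%VS by rewrite SubK.
exists f; split=> //; apply/setP => p; rewrite inE; apply/existsP/imsetP.
  case=> u /andP[/par_repr[c [o [c0 ->]]] /eqP pE].
  exists o => //; apply: val_inj; rewrite pE vf veroneseZ -scalemxAl vline_scale //.
  by rewrite expf_neq0.
by case=> o _ ->; exists (par o); rewrite par_neq0 vf eqxx.
Qed.

Lemma card_rnc d (E : 'M[F]_(d.+1, n.+1)) : (0 < d)%N -> row_free E -> #|rnc E| = #|F|.+1.
Proof.
move=> d0 fE; have [f [vf ->]] := rnc_repr fE.
rewrite card_imset ?cardsT ?card_option // => o o' /(congr1 val).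
rewrite !vf => /eqP; rewrite eqEsubv -memvE => /andP[/vlineP[k]].
rewrite scalemxAl => /(row_free_inj fE) e _.
exact: veronese_par_inj e.
Qed.

(** A linear form vanishing on U but not on the span of the curve restricts to a
    nonzero binary form of degree d in the parameter. *)
Lemma rnc_cap_le d (E : 'M[F]_(d.+1, n.+1)) (U : vs) : row_free E ->
  ~~ (rowvs E <= U)%VS -> (#|rnc E :&: points_of U| <= d)%N.
Proof.
move=> fE /subvPn[_ /rowvsP[w ->] /linear_form_separating[phi [phiU phiw]]].
have [f [vf ->]] := rnc_repr fE.
have /binary_form_zeros : E *m phi != 0.
  by apply: contraNneq phiw => E0; rewrite -mulmxA E0 mulmx0.
apply: leq_trans; set A := [set o | _].
apply: leq_trans (leq_imset_card f A); apply: subset_leq_card.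
apply/subsetP => p; rewrite inE => /andP[/imsetP[o _ ->]].
rewrite in_points vf -memvE => /phiU; rewrite -mulmxA => o0.
by apply/imsetP; exists o; rewrite // inE o0 mxE.
Qed.

Lemma rnc_sub d (E : 'M[F]_(d.+1, n.+1)) : row_free E -> rnc E \subset points_of (rowvs E).
Proof.
move=> fE; have [f [vf ->]] := rnc_repr fE.
by apply/subsetP => _ /imsetP[o _ ->]; rewrite in_points vf -memvE mem_rowvs.
Qed.

Lemma rncP d (E : 'M[F]_(d.+1, n.+1)) (p : PG F n) :
  reflect (exists2 u, u != 0 & val p = <[veronese d u *m E]>%VS) (p \in rnc E).
Proof.
rewrite inE; apply: (iffP existsP) => [[u /andP[u0 /eqP]]|[u u0 pE]]; exists u => //.
by rewrite u0 pE eqxx.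
Qed.

Lemma veronese1 (u : 'rV[F]_2) : veronese 1 u = u.
Proof.
rewrite [RHS]row2E; apply/rowP => j; rewrite !mxE.
by case: j => [[|[|j]] jl] //=; rewrite ?subn0 ?subnn ?expr1 ?expr0 ?mulr1 ?mul1r.
Qed.

Lemma points_of_line (E : 'M[F]_(2, n.+1)) : row_free E ->
  points_of (rowvs E) = rnc E.
Proof.
move=> fE; apply/eqP; rewrite eqEsubset rnc_sub // andbT.
apply/subsetP => p; rewrite in_points; have [v v0 pE] := PG_vec p.
rewrite pE -memvE => /rowvsP[w vE]; apply/rncP; exists w.
  by apply: contra_neq v0 => w0; rewrite vE w0 mul0mx.
by rewrite veronese1 -vE.
Qed.

Lemma card_line (L : vs) : \dim L = 2%N -> #|points_of L| = #|F|.+1.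
Proof. by case/rowvs_basis => E fE <-; rewrite points_of_line // card_rnc. Qed.

End RationalNormalCurves.

(** * Non-degenerate conics *)

Section Conics.
Variables (F : finFieldType) (n : nat).
Local Notation V := 'rV[F]_n.+1.
Local Notation vs := {vspace V}.
Local Open Scope ring_scope.
Implicit Types (A : 'M[F]_n.+1) (v w : V) (E : 'M[F]_(3, n.+1)) (y : 'rV[F]_3).

Lemma sum3 (T : zmodType) (f : 'I_3 -> T) : \sum_i f i = f 0 + f 1 + f ord_max.
Proof.
rewrite !big_ord_recl big_ord0 addr0 addrA.
by congr (f _ + f _ + f _); apply: val_inj.
Qed.

Lemma sum2 (T : zmodType) (f : 'I_2 -> T) : \sum_i f i = f 0 + f 1.
Proof.
rewrite !big_ord_recl big_ord0 addr0.
by congr (f _ + f _); apply: val_inj.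
Qed.

Definition polar A v w := qform A (v + w) - qform A v - qform A w.

Lemma polarE A v w : polar A v w = (v *m A *m w^T) 0 0 + (w *m A *m v^T) 0 0.
Proof.
rewrite /polar /qform linearD /= !mulmxDl !mulmxDr !mxE; ring.
Qed.

Lemma polarC A v w : polar A v w = polar A w v.
Proof. by rewrite !polarE addrC. Qed.

Lemma polarDl A v v' w : polar A (v + v') w = polar A v w + polar A v' w.
Proof. rewrite !polarE linearD /= !mulmxDl !mulmxDr !mxE; ring. Qed.

Lemma polarZl A k v w : polar A (k *: v) w = k * polar A v w.
Proof. by rewrite !polarE linearZ /= -!scalemxAl -!scalemxAr !mxE mulrDr. Qed.

Lemma polarDr A v v' w : polar A w (v + v') = polar A w v + polar A w v'.
Proof. by rewrite polarC polarDl !(polarC _ w). Qed.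

Lemma polarZr A k v w : polar A w (k *: v) = k * polar A w v.
Proof. by rewrite polarC polarZl (polarC _ w). Qed.

Lemma qformD A v w : qform A (v + w) = qform A v + qform A w + polar A v w.
Proof. rewrite /polar; ring. Qed.

Lemma qformZ A k v : qform A (k *: v) = k ^+ 2 * qform A v.
Proof. by rewrite /qform linearZ /= -!scalemxAl -!scalemxAr !mxE mulrA -expr2. Qed.

Lemma polarvv A v : polar A v v = qform A v *+ 2.
Proof. by rewrite polarE. Qed.

Lemma veronese2E (u : 'rV[F]_2) :
  (veronese 2 u 0 0 = u 0 0 ^+ 2) * (veronese 2 u 0 1 = u 0 0 * u 0 1) *
  (veronese 2 u 0 ord_max = u 0 1 ^+ 2).
Proof. by rewrite !mxE /= !expr0 mulr1 mul1r. Qed.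

Lemma row3P y y' : y 0 0 = y' 0 0 -> y 0 1 = y' 0 1 -> y 0 ord_max = y' 0 ord_max ->
  y = y'.
Proof.
move=> e0 e1 e2; apply/rowP => -[[|[|[|i]]] il] //.
- by move: e0; rewrite (_ : 0 = Ordinal il) //; apply: val_inj.
- by move: e1; rewrite (_ : 1 = Ordinal il) //; apply: val_inj.
- by move: e2; rewrite (_ : ord_max = Ordinal il) //; apply: val_inj.
Qed.

(** The quadratic form whose zeros are the points (s^2, st, t^2). *)
Definition cone_coord y := y 0 1 ^+ 2 - y 0 0 * y 0 ord_max.

(** If y0 != 0 then y1^2 = y0 y2 makes y a multiple of the Veronese image of (y0, y1);
    otherwise y is a multiple of the image of (0, 1). *)
Lemma rnc2_quadric E A c : row_free E -> c != 0 ->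
  (forall y, qform A (y *m E) = c * cone_coord y) ->
  [set p in points_of (rowvs E) |
    [forall v : V, (v \in val p) ==> (qform A v == 0)]] = rnc E.
Proof.
move=> fE c0 QE; apply/setP => p; rewrite [LHS]inE in_points.
apply/andP/rncP => [[pE /forallP Q]|[u u0 pE]]; last first.
  split; first by rewrite pE -memvE mem_rowvs.
  apply/forallP => v; apply/implyP; rewrite pE => /vlineP[k ->].
  rewrite qformZ QE /cone_coord !veronese2E.
  by apply/eqP; ring.
have [v v0 pv] := PG_vec p; move: pE; rewrite pv -memvE => /rowvsP[y vE].
have /implyP := Q v; rewrite pv memv_line => /(_ isT).
rewrite vE QE mulf_eq0 (negPf c0) /= /cone_coord => /eqP y0.
have [a0|a0] := eqVneq (y 0 0) 0.
  have b0 : y 0 1 = 0.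
    by move: y0; rewrite a0 mul0r subr0 => /eqP; rewrite sqrf_eq0 => /eqP.
  exists (row2 0 1); first exact: (par_neq0 None).
  have yv : y = y 0 ord_max *: veronese 2 (row2 0 1).
    by apply: row3P; rewrite mxE veronese2E !mxE ?a0 ?b0 /= ?expr1n; ring.
  rewrite yv -scalemxAl vline_scale //; apply: contra_neq v0 => m0.
  by rewrite vE yv m0 scale0r mul0mx.
exists (row2 (y 0 0) (y 0 1)).
  by apply/rV0Pn; exists 0; rewrite mxE.
have yv : y = (y 0 0)^-1 *: veronese 2 (row2 (y 0 0) (y 0 1)).
  move/eqP: y0; rewrite subr_eq0 => /eqP y0.
  by apply: row3P; rewrite mxE veronese2E !mxE /= ?y0 ?expr2 ?mulKf.
by rewrite {1}yv -scalemxAl vline_scale // invr_eq0.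
Qed.

Lemma conic_of_rnc E : row_free E -> nondegenerate_conic (rowvs E) (rnc E).
Proof.
move=> fE; split; first exact: dim_rowvs.
pose J : 'M[F]_3 := \matrix_(i, j) (((i == 1) && (j == 1))%:R - ((i == 0) && (j == ord_max))%:R).
have /row_freeP[B EI] := fE; pose A := B *m J *m B^T.
have QJ y : qform A (y *m E) = 1 * cone_coord y.
  have IE : B^T *m E^T = 1%:M by rewrite -trmx_mul EI trmx1.
  rewrite /qform /A trmx_mul !mulmxA -[y *m E *m _]mulmxA EI mulmx1.
  rewrite -[_ *m B^T *m _]mulmxA IE mulmx1 mxE sum3 !mxE !sum3 !mxE /= /cone_coord; ring.
exists A; last by rewrite (rnc2_quadric fE (oner_neq0 F) QJ).
move=> _ /rowvsP[y ->] Q0 B0.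
have {}B0 z : cone_coord (y + z) - cone_coord y - cone_coord z = 0.
  by rewrite -[RHS](B0 (z *m E)) ?mem_rowvs // -mulmxDl !QJ !mul1r.
have := B0 (delta_mx 0 0); have := B0 (delta_mx 0 ord_max).
rewrite /cone_coord !mxE /= => y0 y2.
move: Q0; rewrite QJ mul1r /cone_coord => Q0.
have {}y0 : y 0 0 = 0 by rewrite -[RHS]oppr0 -[in RHS]y0; ring.
have {}y2 : y 0 ord_max = 0 by rewrite -[RHS]oppr0 -[in RHS]y2; ring.
move: Q0; rewrite y0 mul0r subr0 => /eqP; rewrite sqrf_eq0 => /eqP y1.
suff -> : y = 0 by rewrite mul0mx.
by apply: row3P; rewrite mxE.
Qed.

(** An isotropic vector e of the form is completed to a hyperbolic pair e, f, and a
    vector z of the plane orthogonal to both is not isotropic, for otherwise it would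
    lie in the radical. In the basis e, z and a suitable multiple of f the form is a
    multiple of y1^2 - y0 y2. The empty set stands for a form without isotropic
    vectors. *)
Lemma rnc_of_conic P X : nondegenerate_conic P X ->
  X = set0 \/ exists E, [/\ row_free E, rowvs E = P & X = rnc E].
Proof.
case=> dP [A ndA XE]; have [->|[x xX]] := set_0Vmem X; [by left|right].
move: xX; rewrite XE inE in_points => /andP[xP /forallP xQ].
have [e e0 xe] := PG_vec x; rewrite xe -memvE in xP.
have eQ : qform A e = 0 by apply/eqP; apply: (implyP (xQ e)); rewrite xe memv_line.
have [w wP ew] : exists2 w, w \in P & polar A e w != 0.
  have [/exists_inP[w wP ew]|] := boolP [exists w : V in P, polar A e w != 0]; first by exists w.
  rewrite negb_exists_in => /forall_inP B0; case/eqP: e0; apply: ndA => // w wP.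
  by apply/eqP; have := B0 w wP; rewrite negbK.
(* f is the second isotropic vector of the plane spanned by e and w *)
pose a := polar A e w; pose f := w - (qform A w / a) *: e.
have fP : f \in P by rewrite memvB ?memvZ.
have efa : polar A e f = a.
  by rewrite polarDr -scaleNr polarZr polarvv eQ mul0rn mulr0 addr0.
have fQ : qform A f = 0.
  rewrite qformD -scaleNr qformZ eQ mulr0 addr0 polarZr (polarC _ w) -/a.
  by rewrite mulNr divfK ?subrr.
have [z0 z0P z0ef] : exists2 z, z \in P & z \notin (<[e]> + <[f]>)%VS.
  apply/subvPn; apply/negP => /dimvS; rewrite dP.
  have := (dimv_add_leqif <[e]> <[f]>)%VS; case=> le1 _ le2.
  have := leq_trans le2 le1; rewrite !dim_vline.
  by case: (_ != _); case: (_ != _).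
pose z := z0 - (polar A z0 f / a) *: e - (polar A z0 e / a) *: f.
have zP : z \in P by rewrite !memvB ?memvZ.
have zn0 : z != 0.
  apply: contraNneq z0ef => /eqP; rewrite /z subr_eq0 subr_eq => /eqP ->.
  by rewrite addrC memv_add ?memvZ ?memv_line.
have ze : polar A z e = 0.
  rewrite !polarDl -!scaleNr !polarZl polarvv eQ (polarC _ f) efa mul0rn.
  by field; rewrite ew.
have zf : polar A z f = 0.
  rewrite !polarDl -!scaleNr !polarZl polarvv fQ efa mul0rn.
  by field; rewrite ew.
pose Ef (g : V) : 'M[F]_(3, n.+1) := \matrix_i [:: e; z; g]`_i.
have EfE g y : y *m Ef g = y 0 0 *: e + y 0 1 *: z + y 0 ord_max *: g.
  by rewrite mulmx_sum_row sum3 !rowK.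
have base k : k != 0 -> row_free (Ef (k *: f)) /\ rowvs (Ef (k *: f)) = P.
  move=> k0; have fr : row_free (Ef (k *: f)).
    apply: inj_row_free => y; rewrite EfE => y0.
    have := congr1 (fun v => polar A v f) y0; have := congr1 (fun v => polar A v e) y0.
    have p0 v : polar A 0 v = 0 by rewrite -[0](scale0r 0) polarZl mul0r.
    rewrite !p0 !polarDl !polarZl !polarvv eQ fQ efa (polarC _ f) efa ze zf.
    rewrite !mul0rn !mulr0 !add0r !addr0 => /eqP; rewrite mulrA !mulf_eq0 (negPf k0) (negPf ew).
    rewrite !orbF => /eqP y2 /eqP; rewrite mulf_eq0 (negPf ew) orbF => /eqP y1.
    move: y0; rewrite y1 y2 !scale0r add0r addr0 => /eqP; rewrite scaler_eq0 (negPf zn0) orbF.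
    by move=> /eqP y3; apply: row3P; rewrite mxE.
  split=> //; apply/eqP; rewrite eqEdim dim_rowvs // dP leqnn andbT.
  by apply/subvP => _ /rowvsP[y ->]; rewrite EfE !rpredD ?memvZ.
(* rescaling f by - c / a turns c y1^2 + a y0 y2 into c (y1^2 - y0 y2) *)
pose c := qform A z.
have c0 : c != 0.
  have [fr PE] := base 1 (oner_neq0 F); apply: contra_neq zn0 => Q0; apply: ndA => // v.
  rewrite -PE => /rowvsP[y ->]; rewrite -/(polar _ _ _) EfE !polarDr !polarZr ze zf polarvv.
  by rewrite -/c Q0; ring.
have ca0 : - c / a != 0 by rewrite mulf_neq0 ?oppr_eq0 ?invr_eq0.
have [fr PE] := base _ ca0; exists (Ef ((- c / a) *: f)); split=> //.
rewrite -(rnc2_quadric (A := A) fr c0) ?PE // => y.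
rewrite EfE !qformD !qformZ eQ fQ -/c !polarDl !polarZl !polarZr efa zf (polarC _ e z) ze /cone_coord.
by field; rewrite ew.
Qed.

End Conics.

(** * The pencil of hyperplanes through a plane *)

Section Pencil.
Variable F : finFieldType.
Local Notation vs := {vspace 'rV[F]_5}.
Local Notation q := #|F|.
Implicit Types (P H L : vs) (p : PG F 4) (X : {set PG F 4}).

Definition pencil P : {set vs} := [set H | (\dim H == 4) && (P <= H)%VS].

Lemma pencilP P H : reflect (\dim H = 4 /\ (P <= H)%VS) (H \in pencil P).
Proof. by rewrite inE; apply: (iffP andP) => -[/eqP]. Qed.

Lemma pencil_add P p H : \dim P = 3 -> p \notin points_of P ->
  (H \in pencil P) && (p \in points_of H) = (H == (P + val p)%VS).
Proof.
move=> dP pP; have dPp := dim_add_point pP; rewrite in_points.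
apply/andP/eqP => [[/pencilP[dH PH] pH]|->].
  by apply/esym/eqP; rewrite eqEdim subv_add PH pH dPp dP dH.
by split; [apply/pencilP; rewrite dPp dP addvSl | rewrite addvSr].
Qed.

(** A complement of P is a line whose points are in bijection with the hyperplanes
    of the pencil. *)
Lemma card_pencil P : \dim P = 3 -> #|pencil P| = q.+1.
Proof.
move=> dP; have dC : \dim (P^C)%VS = 2 by rewrite dimv_compl dim_ambient dP.
have nP p : p \in points_of (P^C)%VS -> p \notin points_of P.
  move=> pC; apply/negP => pP.
  have : p \in points_of (P :&: P^C)%VS by rewrite -points_ofI inE pP.
  by rewrite capv_compl points_of0 inE.
have -> : pencil P = [set (P + val p)%VS | p in points_of (P^C)%VS].
  apply/setP => H; apply/idP/imsetP => [HP|[p /nP pP ->]]; last first.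
    by have := eqxx (P + val p)%VS; rewrite -pencil_add // => /andP[].
  have [dH PH] := pencilP _ _ HP.
  have := dim_capv_in (subvf H) (subvf (P^C)%VS); rewrite dH dC dim_ambient => d.
  have [|p] := @point_exists _ _ (H :&: P^C)%VS; first by lia.
  rewrite -points_ofI inE => /andP[pH pC]; exists p => //.
  by apply/eqP; rewrite -pencil_add ?HP // nP.
rewrite card_in_imset ?card_line // => p p' pC p'C e.
apply: contraTeq isT => pp' /=; rewrite -(ltnn 5).
have : (fullv <= P + val p)%VS.
  rewrite -(addv_complf P) subv_add addvSl; apply: (line_through dC pp') => //.
    by rewrite in_points addvSr.
  by rewrite e in_points addvSr.
by move/dimvS; rewrite dim_ambient dim_add_point ?nP // dP.
Qed.

Lemma card_points_cap X H : #|points_of H :&: X| = \sum_(p in X) (p \in points_of H).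
Proof.
rewrite -sum1_card big_mkcond [RHS]big_mkcond; apply: eq_bigr => p _.
by rewrite inE andbC; case: (p \in X).
Qed.

(** A point off P lies on exactly one of the q + 1 hyperplanes of the pencil, and a
    point of P on all of them. *)
Lemma pencil_sum P X : \dim P = 3 ->
  \sum_(H in pencil P) #|points_of H :&: X| = #|X| + q * #|points_of P :&: X|.
Proof.
move=> dP; under eq_bigr => H _ do rewrite card_points_cap.
rewrite exchange_big /= card_points_cap big_distrr /= -sum1_card -big_split /=.
apply: eq_bigr => p pX; have [pP|pP] := boolP (p \in _).
  rewrite muln1 add1n -(card_pencil dP) -sum1_card; apply: eq_bigr => H.
  by case/pencilP => _ /points_ofS/subsetP->.
rewrite muln0 addn0 (bigD1 (P + val p)%VS) /=; last first.
  by have := eqxx (P + val p)%VS; rewrite -pencil_add // => /andP[].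
rewrite big1 => [|H /andP[HP Hp]]; first by rewrite in_points addvSr.
by apply/eqP; rewrite eqb0; apply: contra Hp => pH; rewrite -pencil_add ?HP.
Qed.

End Pencil.

(** * The five kinds of hyperplane sections *)

Definition kline (F : finFieldType) (K : {set PG F 4}) (L : {vspace 'rV[F]_5}) : bool :=
  (\dim L == 2) && (points_of L \subset K).

Definition klines (F : finFieldType) (K : {set PG F 4}) (H : {vspace 'rV[F]_5}) :
    {set {vspace 'rV[F]_5}} :=
  [set L | kline K L && (L <= H)%VS].

Section Sections.
Variable F : finFieldType.
Local Notation vs := {vspace 'rV[F]_5}.
Local Notation q := #|F|.
Implicit Types (P H L : vs) (p : PG F 4) (X S : {set PG F 4}).

(** Ls is the set of lines contained in S, determined by the kind of S; most of the
    incidence arguments only use this set and the size of S. *)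
Inductive section_spec S (Ls : {set vs}) : Prop :=
| OneLine L of \dim L = 2 & S = points_of L & Ls = [set L]
| TwoLines L1 L2 of \dim L1 = 2 & \dim L2 = 2 & L1 != L2 &
    S = points_of L1 :|: points_of L2 & Ls = [set L1; L2]
| ThreeLines L1 L2 L3 of \dim L1 = 2 & \dim L2 = 2 & \dim L3 = 2 &
    [&& L1 != L2, L1 != L3 & L2 != L3] &
    S = points_of L1 :|: points_of L2 :|: points_of L3 & Ls = [set L1; L2; L3]
| LineConic L (E : 'M[F]_(3, 5)) of \dim L = 2 & row_free E &
    S = points_of L :|: rnc E & Ls = [set L]
| TwistedCubic (E : 'M[F]_(4, 5)) of row_free E & S = rnc E & Ls = set0.

Lemma cover3_card (X S1 S2 S3 : {set PG F 4}) a b c :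
  #|X :&: S1| <= a -> #|X :&: S2| <= b -> #|X :&: S3| <= c ->
  X \subset S1 :|: S2 :|: S3 -> #|X| <= a + b + c.
Proof.
move=> h1 h2 h3 /setIidPl <-; rewrite !setIUr.
have u (A B : {set PG F 4}) : #|A :|: B| <= #|A| + #|B| by rewrite -cardsUI leq_addr.
apply: (leq_trans (u _ _)); rewrite leq_add //.
by apply: (leq_trans (u _ _)); rewrite leq_add.
Qed.

Lemma cover2_card (X S1 S2 : {set PG F 4}) a b :
  #|X :&: S1| <= a -> #|X :&: S2| <= b -> X \subset S1 :|: S2 -> #|X| <= a + b.
Proof.
move=> h1 h2 XS; rewrite -[_ + b]addn0; apply: (cover3_card h1 h2 (S3 := set0)).
  by rewrite setI0 cards0.
by rewrite setU0.
Qed.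

Lemma rnc_cap_line d (E : 'M[F]_(d.+1, 5)) L : 1 < d -> row_free E -> \dim L = 2 ->
  #|points_of L :&: rnc E| <= d.
Proof.
move=> d1 fE dL; rewrite setIC rnc_cap_le //.
by apply/negP => /dimvS; rewrite dim_rowvs // dL; lia.
Qed.

Lemma distinct_lines_cap L L1 : \dim L = 2 -> \dim L1 = 2 -> (L == L1) = false ->
  #|points_of L :&: points_of L1| <= 1.
Proof. by move=> dL dL1 /negbT; exact: line_cap_line. Qed.

(** The q + 1 >= 4 points of a line cannot be shared out between three other lines,
    another line and a conic, or a twisted cubic: these contain at most 3, 3 and 3 of
    them. A line with an empty conic is a single line. *)
Lemma sectionP (q_ge3 : 3 <= q) (K : {set PG F 4}) H (S := points_of H :&: K) :
  is_line S \/ two_lines S \/ three_lines S \/ line_and_conic S \/ twisted_cubic S ->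
  section_spec S (klines K H).
Proof.
set Ls := klines K H.
have inLs L : (L \in Ls) = (\dim L == 2) && (points_of L \subset S).
  by rewrite inE -andbA; case: eqP => //= _; rewrite subsetI points_of_subset andbC.
case=> [[L dL SE]|[[_ [_ [[L1 d1 ->] [L2 d2 ->] n12 SE]]]|]].
- apply: (OneLine dL SE); apply/setP => M; rewrite inLs inE SE points_of_subset.
  by apply/andP/eqP => [[/eqP dM ML]|->]; [apply/eqP; rewrite eqEdim ML dM dL | rewrite dL].
- have n12' : L1 != L2 by apply: contra_not_neq n12 => ->.
  apply: (TwoLines d1 d2 n12' SE); apply/setP => M; rewrite inLs !inE SE.
  apply/andP/orP => [[/eqP dM MS]|]; last first.
    by case=> /eqP->; rewrite ?d1 ?d2 eqxx ?subsetUl ?subsetUr.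
  apply/orP; case: eqP => //= /eqP /negPf m1; case: eqP => //= /eqP /negPf m2.
  have := cover2_card (distinct_lines_cap dM d1 m1) (distinct_lines_cap dM d2 m2) MS.
  by rewrite card_line //; lia.
case=> [[_ [_ [_ [[[L1 d1 ->] [L2 d2 ->] [L3 d3 ->]] [n12 n13 n23 SE]]]]]|].
  have n123 : [&& L1 != L2, L1 != L3 & L2 != L3].
    by apply/and3P; split; [move: n12|move: n13|move: n23]; apply: contra_not_neq => ->.
  apply: (ThreeLines d1 d2 d3 n123 SE); apply/setP => M; rewrite inLs !inE SE.
  apply/andP/orP => [[/eqP dM MS]|]; last first.
    case=> [/orP[]|] /eqP->; rewrite ?d1 ?d2 ?d3 eqxx ?subsetUr //; split=> //.
      by rewrite -setUA subsetUl.
    by rewrite -setUA setUCA subsetUl.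
  apply/orP; case: eqP => //= /eqP /negPf m1; case: eqP => //= /eqP /negPf m2.
  case: eqP => //= /eqP /negPf m3.
  have := cover3_card (distinct_lines_cap dM d1 m1) (distinct_lines_cap dM d2 m2)
    (distinct_lines_cap dM d3 m3) MS.
  by rewrite card_line //; lia.
case=> [[_ [c [P [[L dL ->] /rnc_of_conic cE SE]]]]|[E fE SE]]; last first.
  apply: (TwistedCubic fE SE); apply/setP => M; rewrite inLs SE inE.
  apply/negP => /andP[/eqP dM /setIidPl ME].
  have := rnc_cap_line (isT : 1 < 3) fE dM.
  by rewrite ME card_line //; lia.
case: cE => [c0|[E [fE _ cE]]].
  move: SE; rewrite c0 setU0 => SE.
  apply: (OneLine dL SE); apply/setP => M; rewrite inLs inE SE points_of_subset.
  by apply/andP/eqP => [[/eqP dM ML]|->]; [apply/eqP; rewrite eqEdim ML dM dL | rewrite dL].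
rewrite cE in SE; apply: (LineConic dL fE SE); apply/setP => M; rewrite inLs !inE SE.
apply/andP/eqP => [[/eqP dM MS]|->]; last by rewrite dL subsetUl.
apply/eqP; case: eqP => //= /eqP /negPf m1.
have := cover2_card (distinct_lines_cap dM dL m1) (rnc_cap_line (isT : 1 < 2) fE dM) MS.
by rewrite card_line //; lia.
Qed.

End Sections.

(** * Counting incidences *)

Section Cover.
Variable F : finFieldType.
Local Notation vs := {vspace 'rV[F]_5}.
Implicit Types (P H L M : vs) (p : PG F 4) (X : {set PG F 4}) (R : {set vs}).

Lemma sum_incidence X R :
  \sum_(r in R) #|X :&: points_of r| = \sum_(p in X) #|[set r in R | p \in points_of r]|.
Proof.
transitivity (\sum_(r in R) \sum_(p in X) (p \in points_of r)).
  by apply: eq_bigr => r _; rewrite setIC card_points_cap.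
rewrite exchange_big; apply: eq_bigr => p _ /=.
rewrite -sum1_card big_mkcond [RHS]big_mkcond; apply: eq_bigr => r _.
by rewrite inE; case: (r \in R); case: (p \in points_of r).
Qed.

Lemma cover_le X R : (forall p, p \in X -> exists2 r, r \in R & p \in points_of r) ->
  (forall r, r \in R -> #|X :&: points_of r| <= 1) -> #|X| <= #|R|.
Proof.
move=> cov le1; apply: (@leq_trans (\sum_(r in R) #|X :&: points_of r|)).
  rewrite sum_incidence -sum1_card; apply: leq_sum => p /cov[r rR pr].
  by rewrite card_gt0; apply/set0Pn; exists r; rewrite inE rR.
by rewrite -sum1_card; apply: leq_sum.
Qed.

(** Double counting of incidences. *)
Lemma partition_card X R :
  (forall p, p \in X -> exists2 r, r \in R & p \in points_of r) ->
  (forall p r r', p \in X -> r \in R -> r' \in R ->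
     p \in points_of r -> p \in points_of r' -> r = r') ->
  #|X| = \sum_(r in R) #|X :&: points_of r|.
Proof.
move=> cov uni; rewrite sum_incidence -sum1_card; apply: eq_bigr => p pX.
have [r rR pr] := cov p pX; apply/esym/eqP/cards1P; exists r; apply/setP => r'.
by rewrite !inE -in_points; apply/andP/eqP => [[r'R pr']|->//]; apply: uni r'R rR pr' pr.
Qed.

Lemma coplanar_meet P L M : \dim P = 3 -> \dim L = 2 -> \dim M = 2 ->
  (L <= P)%VS -> (M <= P)%VS -> exists2 p, p \in points_of L & p \in points_of M.
Proof.
move=> dP dL dM LP MP; have := dim_capv_in LP MP; rewrite dL dM dP => d.
have [|p] := @point_exists _ _ (L :&: M)%VS; first by lia.
by rewrite -points_ofI inE => /andP[pL pM]; exists p.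
Qed.

Lemma dim_add_meeting L M p : \dim L = 2 -> \dim M = 2 -> L != M ->
  p \in points_of L -> p \in points_of M -> \dim (L + M)%VS = 3.
Proof.
move=> dL dM LM pL pM; have := dimv_sum_cap L M; rewrite dL dM.
have : \dim (L :&: M)%VS = 1; last lia.
apply/eqP; rewrite eqn_leq; apply/andP; split.
  have := dimvS (capvSl L M); rewrite dL leq_eqVlt => /orP[/eqP d|//].
  case/negP: LM; rewrite eqEdim dL dM leqnn andbT.
  by apply/capv_idPl/eqP; rewrite eqEdim capvSl d dL.
by rewrite -[X in X <= _](dim_point p) dimvS // subv_cap; move: pL pM; rewrite !in_points => -> ->.
Qed.

End Cover.

(** * Sizes and lines of the sections *)

Section LinesOfK.
Variables (F : finFieldType) (K : {set PG F 4}).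
Local Notation vs := {vspace 'rV[F]_5}.
Local Notation q := #|F|.
Implicit Types (P H L M : vs) (p : PG F 4) (X : {set PG F 4}).

Local Notation kline := (kline K).
Local Notation klines := (klines K).

Hypothesis q_ge3 : 3 <= q.
Hypothesis sect : forall H, \dim H = 4 -> section_spec (points_of H :&: K) (klines H).

Lemma kline_dim L : kline L -> \dim L = 2.
Proof. by case/andP => /eqP. Qed.

Lemma kline_sub L p : kline L -> p \in points_of L -> p \in K.
Proof. by case/andP => _ /subsetP; apply. Qed.

Lemma klinesP L H : reflect (kline L /\ (L <= H)%VS) (L \in klines H).
Proof. by rewrite inE; apply: andP. Qed.

Lemma klines_le3 H : \dim H = 4 -> #|klines H| <= 3.
Proof.
move/sect; case=> [L _ _|L1 L2 _ _ _ _|L1 L2 L3 _ _ _ _ _|L E _ _ _|E _ _] ->.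
- by rewrite cards1.
- by rewrite cards2; case: (_ != _).
- by rewrite setUC cardsU1 cards2; case: (_ \notin _); case: (_ != _).
- by rewrite cards1.
- by rewrite cards0.
Qed.

(** A hyperplane containing a and b contains at most one further line of K. *)
Lemma third_kline_unique H a b c d : \dim H = 4 -> a \in klines H -> b \in klines H ->
  c \in klines H -> d \in klines H -> a != b -> c != a -> c != b -> d != a -> d != b ->
  c = d.
Proof.
move=> /klines_le3 le3 aH bH cH dH ab ca cb da db; apply: contraTeq le3 => cd.
rewrite -ltnNge; have : [set c; d; a; b] \subset klines H.
  by apply/subsetP => x; rewrite !in_setU !in_set1 -!orbA => /or4P[] /eqP->.
move/subset_leq_card; apply: leq_trans.
rewrite -!setUA cardsU1 cardsU1 cards2 ab !inE !negb_or cd ca cb da db //.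
Qed.

Lemma card_kline L : kline L -> #|points_of L| = q.+1.
Proof. by move/kline_dim/card_line. Qed.

Lemma section_card H : \dim H = 4 ->
  #|points_of H :&: K| = q.+1 \/ 2 * q <= #|points_of H :&: K|.
Proof.
move/sect; case=> [L dL -> _|L1 L2 d1 d2 n12 -> _|L1 L2 L3 d1 d2 _ /and3P[n12 _ _] -> _
    |L E dL fE -> _|E fE -> _].
- by left; rewrite card_line.
- right; rewrite cardsU !card_line //; have := line_cap_line d1 d2 n12; lia.
- right; apply: (@leq_trans #|points_of L1 :|: points_of L2|).
    rewrite cardsU !card_line //; have := line_cap_line d1 d2 n12; lia.
  by rewrite subset_leq_card // subsetUl.
- right; rewrite cardsU card_line // card_rnc //.
  by have := rnc_cap_line (isT : 1 < 2) fE dL; lia.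
- by left; rewrite card_rnc.
Qed.

Lemma section_noline H : \dim H = 4 -> klines H = set0 -> #|points_of H :&: K| = q.+1.
Proof.
move/sect; case=> [L _ _|L1 L2 _ _ _ _|L1 L2 L3 _ _ _ _ _|L E _ _ _|E fE SE] ->.
- by move/setP/(_ L); rewrite !inE eqxx.
- by move/setP/(_ L1); rewrite !inE eqxx.
- by move/setP/(_ L1); rewrite !inE eqxx.
- by move/setP/(_ L); rewrite !inE eqxx.
- by rewrite SE card_rnc.
Qed.

(** Only unions of lines contain two lines. *)
Lemma section_covered H L M p : \dim H = 4 -> L \in klines H -> M \in klines H ->
  L != M -> p \in points_of H -> p \in K -> exists2 R, R \in klines H & p \in points_of R.
Proof.
move=> dH LH MH LM pH pK; have : p \in points_of H :&: K by rewrite inE pH.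
move: LH MH; case: (sect dH) => [L0 _ _|L1 L2 _ _ _ ->|L1 L2 L3 _ _ _ _ ->|L0 E _ _ _|E _ _] ->.
- by rewrite !inE => /eqP LE /eqP ME; rewrite LE ME eqxx in LM.
- by move=> _ _; rewrite in_setU => /orP[pL|pL]; [exists L1|exists L2];
    rewrite // !inE eqxx ?orbT.
- by move=> _ _; rewrite !in_setU => /orP[/orP[pL|pL]|pL]; [exists L1|exists L2|exists L3];
    rewrite // !inE eqxx ?orbT.
- by rewrite !inE => /eqP LE /eqP ME; rewrite LE ME eqxx in LM.
- by rewrite inE.
Qed.

Hypothesis card_K : #|K| = q.+1 * q.+1.

(** Every hyperplane section has at least q + 1 points; the sum of the excesses over a
    pencil is known because q + 1 sections of size q + 1 would have (q + 1)^2 = |K|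
    points. *)
Lemma excess_sum P : \dim P = 3 ->
  \sum_(H in pencil P) (#|points_of H :&: K| - q.+1) = q * #|points_of P :&: K|.
Proof.
move=> dP; rewrite sumnB => [|H /pencilP[/section_card[->//|le2] _]]; last by lia.
by rewrite pencil_sum // sum_nat_const card_pencil // card_K; lia.
Qed.

(** In a pencil whose plane meets K some excess is positive, and a section of more than
    q + 1 points contains a line. *)
Lemma exists_kline : exists L, kline L.
Proof.
have [p pK] : exists p, p \in K by apply/set0Pn; rewrite -card_gt0 card_K.
have [|P pP dP] := @superspace_of_dim _ _ (val p) 3; first by rewrite dim_point.
have [/exists_inP[H HP H0]|] := boolP [exists H in pencil P, klines H != set0].
  by have /set0Pn[L /klinesP[kL _]] := H0; exists L.
rewrite negb_exists_in => /forall_inP E0.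
have : q * #|points_of P :&: K| = 0.
  rewrite -excess_sum // big1 // => H HP; have [dH _] := pencilP _ _ HP.
  by rewrite section_noline ?subnn //; apply/eqP; rewrite -[_ == _]negbK E0.
move/eqP; rewrite muln_eq0 cards_eq0 => /orP[/eqP|/eqP/setP/(_ p)]; first by lia.
by rewrite !inE pP pK.
Qed.

Lemma line_avoid2 L A B : \dim L = 2 -> ~~ (L <= A)%VS -> ~~ (L <= B)%VS ->
  exists p, [/\ p \in points_of L, p \notin points_of A & p \notin points_of B].
Proof.
move=> dL LA LB; have [/setP E0|[p]] := set_0Vmem (points_of L :\: (points_of A :|: points_of B)).
  have : points_of L \subset points_of A :|: points_of B.
    apply/subsetP => p pL; have := E0 p; rewrite inE pL andbT [RHS]inE => /negbT.
    by rewrite negbK.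
  by move/(cover2_card (line_cap_le1 dL LA) (line_cap_le1 dL LB)); rewrite card_line //; lia.
by rewrite in_setD in_setU negb_or => /andP[/andP[pA pB] pL]; exists p.
Qed.

(** * The lines of K are not pairwise skew *)

Section Skew.
Hypothesis skew : forall L M p, kline L -> kline M -> p \in points_of L ->
  p \in points_of M -> L = M.

Lemma skew_not_coplanar P L M : \dim P = 3 -> kline L -> kline M -> L != M ->
  (L <= P)%VS -> ~~ (M <= P)%VS.
Proof.
move=> dP kL kM LM LP; apply/negP => MP.
have [p pL pM] := coplanar_meet dP (kline_dim kL) (kline_dim kM) LP MP.
by rewrite (skew kL kM pL pM) eqxx in LM.
Qed.

(** Choose points p1, p2, p3 on the three lines such that p1 p2 does not meet L3 and p3
    lies neither in the plane of L1 and p2 nor in that of L2 and p1. *)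
Lemma plane_avoid3 H L1 L2 L3 :
  L1 \in klines H -> L2 \in klines H -> L3 \in klines H ->
  L1 != L2 -> L1 != L3 -> L2 != L3 ->
  exists P, [/\ \dim P = 3, (P <= H)%VS &
   [&& ~~ (L1 <= P)%VS, ~~ (L2 <= P)%VS & ~~ (L3 <= P)%VS]].
Proof.
move=> /klinesP[k1 H1] /klinesP[k2 H2] /klinesP[k3 H3] n12 n13 n23.
have nin p L M : kline L -> kline M -> L != M -> p \in points_of L -> p \notin points_of M.
  by move=> kL kM LM pL; apply: contraNN LM => pM; rewrite (skew kL kM pL pM).
have [p1 p1L] : exists p, p \in points_of L1 by apply: point_exists; rewrite (kline_dim k1).
have p13 := nin _ _ _ k1 k3 n13 p1L; have p12 := nin _ _ _ k1 k2 n12 p1L.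
have d13 : \dim (L3 + val p1)%VS = 3 by rewrite dim_add_point // (kline_dim k3).
have n213 : ~~ (L2 <= L3 + val p1)%VS.
  by apply: (skew_not_coplanar d13 k3 k2); rewrite ?addvSl // eq_sym.
have [p2 [p2L p2n _]] := line_avoid2 (kline_dim k2) n213 n213.
have p21 : p2 \notin points_of L1 by apply: nin p2L; rewrite // eq_sym.
have d1 : \dim (L1 + val p2)%VS = 3 by rewrite dim_add_point // (kline_dim k1).
have d2 : \dim (L2 + val p1)%VS = 3 by rewrite dim_add_point // (kline_dim k2).
have [p3 [p3L p3n1 p3n2]] := line_avoid2 (kline_dim k3)
  (skew_not_coplanar d1 k1 k3 n13 (addvSl _ _)) (skew_not_coplanar d2 k2 k3 n23 (addvSl _ _)).
pose M := (val p1 + val p2)%VS.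
have dM : \dim M = 2.
  rewrite dim_add_point ?dim_point // points_of_point inE.
  by apply: contraNneq p12 => <-.
have M1 : (M <= L1 + val p2)%VS.
  by rewrite addvS //; move: p1L; rewrite in_points.
have M2 : (M <= L2 + val p1)%VS.
  by rewrite addvC addvS //; move: p2L; rewrite in_points.
have p3M : p3 \notin points_of M.
  by apply: contra p3n1; rewrite !in_points => /subv_trans; apply.
have dP : \dim (M + val p3)%VS = 3 by rewrite dim_add_point ?dM.
have [p1H p2H p3H] : [/\ (val p1 <= H)%VS, (val p2 <= H)%VS & (val p3 <= H)%VS].
  by move: p1L p2L p3L; rewrite !in_points; split; apply: subv_trans; eassumption.
exists (M + val p3)%VS; split=> //; first by rewrite !subv_add p1H p2H p3H.
apply/and3P; split.
- apply: contra p3n1 => L1P; rewrite in_points.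
  suff -> : (L1 + val p2 = M + val p3)%VS by rewrite addvSr.
  apply/eqP; rewrite eqEdim d1 dP leqnn subv_add L1P /=.
  by rewrite (subv_trans _ (addvSl _ _)) // addvSr.
- apply: contra p3n2 => L2P; rewrite in_points.
  suff -> : (L2 + val p1 = M + val p3)%VS by rewrite addvSr.
  apply/eqP; rewrite eqEdim d2 dP leqnn subv_add L2P /=.
  by rewrite (subv_trans _ (addvSl _ _)) // addvSl.
- apply/negP => L3P.
  have [s sM sL] := coplanar_meet dP dM (kline_dim k3) (addvSl _ _) L3P.
  have sp1 : s != p1 by apply: contraNneq p13 => <-.
  have sL31 : s \in points_of (L3 + val p1)%VS.
    by move: sL; rewrite !in_points => /subv_trans; apply; exact: addvSl.
  have ML31 : (M <= L3 + val p1)%VS.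
    by apply: (line_through dM sp1) => //; rewrite in_points (addvSl, addvSr).
  by case/negP: p2n; rewrite in_points (subv_trans _ ML31) // addvSr.
Qed.

(** Three skew lines give an excess 2q + 2 in any pencil containing H. A plane P of H
    through none of them meets K in at most 3 points, so the other excesses of its
    pencil add up to at most 3q - (2q + 2) = q - 2. They are 0 or at least q - 1, hence
    all 0, and then q |P :&: K| = 2q + 2, which is impossible for q >= 3. *)
Lemma skew_klines_le2 H : \dim H = 4 -> #|klines H| <= 2.
Proof.
move=> dH; case: (sect dH) => [L _ _|L1 L2 _ _ _ _|L1 L2 L3 d1 d2 d3 /and3P[n12 n13 n23] SE|L E _ _ _|E _ _] LE.
- by rewrite LE cards1.
- by rewrite LE cards2; case: (_ != _).
- have [L1H [L2H L3H]] : L1 \in klines H /\ L2 \in klines H /\ L3 \in klines H.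
    by rewrite LE !inE !eqxx !orbT.
  have [k1 [k2 k3]] : kline L1 /\ kline L2 /\ kline L3.
    by move: L1H L2H L3H => /klinesP[? _] /klinesP[? _] /klinesP[? _].
  have [P [dP PH /and3P[nP1 nP2 nP3]]] := plane_avoid3 L1H L2H L3H n12 n13 n23.
  have HP : H \in pencil P by apply/pencilP.
  have xle : #|points_of P :&: K| <= 3.
    have -> : points_of P :&: K = points_of P :&: (points_of H :&: K).
      by rewrite setIA (setIidPl (points_ofS PH)).
    rewrite SE; have c1 L : \dim L = 2 -> ~~ (L <= P)%VS ->
        #|points_of P :&: (points_of H :&: K) :&: points_of L| <= 1.
      move=> dL /(line_cap_le1 dL); apply: leq_trans; apply: subset_leq_card.
      by rewrite setIC setIS // subsetIl.
    rewrite -SE; apply: (cover3_card (c1 _ d1 nP1) (c1 _ d2 nP2) (c1 _ d3 nP3)).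
    by rewrite SE subsetIr.
  have disj L M : kline L -> kline M -> L != M -> points_of L :&: points_of M = set0.
    move=> kL kM LM; apply/setP => p; rewrite in_setI in_set0; apply/negP => /andP[pL pM].
    by rewrite (skew kL kM pL pM) eqxx in LM.
  have cS : #|points_of H :&: K| = 3 * q.+1.
    rewrite SE cardsU setIUl !disj // setU0 cards0 subn0 cardsU disj // cards0 subn0.
    by rewrite !card_line // !mulSn mul0n addn0 addnA.
  have := excess_sum dP; rewrite (bigD1 H) //= cS => E.
  have [r0|] := eqVneq (\sum_(i in pencil P | i != H) (#|points_of i :&: K| - q.+1)) 0.
    exfalso; move: q_ge3 xle E; rewrite r0; move: #|F| (#|_ :&: _|) => k x.
    by clear; case: x => [|[|[|[|x]]]]; lia.
  rewrite sum_nat_eq0 negb_forall => /existsP[H']; rewrite negb_imply => /andP[HH' e0].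
  move: E; rewrite (bigD1 H') //=; have /andP[/pencilP[dH' _] _] := HH' => E.
  have [h|h] := section_card dH'; first by rewrite h subnn in e0.
  have {}E : 3 * q.+1 - q.+1 + (#|points_of H' :&: K| - q.+1) <= q * #|points_of P :&: K|.
    by rewrite -E leq_add2l leq_addr.
  exfalso; move: q_ge3 xle h E; move: (#|points_of H' :&: K|) #|F| (#|points_of P :&: K|) => s' k x.
  by clear; case: x => [|[|[|[|x]]]]; lia.
- by rewrite LE cards1.
- by rewrite LE cards0.
Qed.

Lemma skew_section_card H : \dim H = 4 -> #|points_of H :&: K| <= 2 * q.+1.
Proof.
move=> dH; have := skew_klines_le2 dH.
case: (sect dH) => [L dL ->|L1 L2 d1 d2 n12 ->|L1 L2 L3 d1 d2 d3 /and3P[n12 n13 n23] ->|L E dL fE ->|E fE ->] ->.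
- by rewrite card_line //; lia.
- by rewrite cardsU !card_line //; lia.
- by rewrite setUC cardsU1 cards2 !inE negb_or n12 ![L3 == _]eq_sym n13 n23.
- by rewrite cardsU !card_line // card_rnc //; lia.
- by rewrite card_rnc //; lia.
Qed.

(** All excesses are at most q + 1, and their sum is q |P :&: K|. *)
Lemma skew_plane_card P : \dim P = 3 -> #|points_of P :&: K| <= q + 2.
Proof.
move=> dP; have : \sum_(H in pencil P) (#|points_of H :&: K| - q.+1) <= q.+1 * q.+1.
  rewrite -[X in _ <= X * _](card_pencil dP) -sum_nat_const.
  apply: leq_sum => H /pencilP[dH _].
  by have := skew_section_card dH; lia.
by rewrite excess_sum //; nia.
Qed.

(** The plane of a line of K and a further point of K has exactly q + 2 points of K, so
    the excesses of its pencil add up to (q + 1)^2 - 1. They are at most q + 1, so one of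
    them is q, and a section of 2q + 1 points is a line and a conic. *)
Lemma skew_line_conic : exists H L (E : 'M[F]_(3, 5)), [/\ \dim H = 4, row_free E &
  points_of H :&: K = points_of L :|: rnc E].
Proof.
have [L kL] := exists_kline.
have [p pK pL] : exists2 p, p \in K & p \notin points_of L.
  apply/subsetPn; apply/negP => /subset_leq_card; rewrite card_K card_kline //; nia.
have dP : \dim (L + val p)%VS = 3 by rewrite dim_add_point // kline_dim.
have xE : #|points_of (L + val p)%VS :&: K| = q + 2.
  apply/eqP; rewrite eqn_leq skew_plane_card //=.
  have : p |: points_of L \subset points_of (L + val p)%VS :&: K.
    rewrite subsetI !subUset !sub1set in_points addvSr pK points_ofS ?addvSl //=.
    by case/andP: kL.
  by move/subset_leq_card; rewrite cardsU1 pL card_kline // addn2 add1n.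
have := excess_sum dP; rewrite xE => E.
have : \sum_(H in pencil (L + val p)%VS) (q.+1 - (#|points_of H :&: K| - q.+1)) = 1.
  rewrite sumnB => [|H /pencilP[/skew_section_card]]; last by lia.
  by rewrite E sum_nat_const card_pencil //; nia.
move/eqP/sum_nat_eq1 => [H [/pencilP[dH _] cH _]].
case: (sect dH) => [M dM SE|L1 L2 d1 d2 n12 SE LE|L1 L2 L3 d1 d2 d3 /and3P[n12 n13 n23] SE LE|M E0 dM fE SE|E0 fE SE].
- by move: cH; rewrite SE card_line //; lia.
- have [/klinesP[k1 _] /klinesP[k2 _]] : L1 \in klines H /\ L2 \in klines H.
    by rewrite LE !inE !eqxx orbT.
  move: cH; rewrite SE cardsU !card_line //.
  have -> : points_of L1 :&: points_of L2 = set0; last by rewrite cards0; lia.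
  apply/setP => r; rewrite in_setI in_set0; apply/negP => /andP[r1 r2].
  by rewrite (skew k1 k2 r1 r2) eqxx in n12.
- have := skew_klines_le2 dH; rewrite LE.
  by rewrite setUC cardsU1 cards2 !inE negb_or n12 ![L3 == _]eq_sym n13 n23.
- by exists H, M, E0.
- by move: cH; rewrite SE card_rnc //; lia.
Qed.

(** Let P be the plane of a conic contained in K. It has too few points of K to contain a
    line of K, while each of the q + 1 hyperplanes through P contains one, because a
    twisted cubic has at most 3 points in P. So K has three lines; two of them span
    a hyperplane whose section consists of just these two, and the third line meets
    it. *)
Lemma not_skew : False.
Proof.
have [H0 [L0 [E [dH0 fE SE]]]] := skew_line_conic.
pose P := rowvs E; have dP : \dim P = 3 by exact: dim_rowvs.
have CK : rnc E \subset points_of P :&: K.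
  rewrite subsetI rnc_sub //; apply: subset_trans (subsetUr (points_of L0) _) _.
  by rewrite -SE subsetIr.
have noP M : kline M -> ~~ (M <= P)%VS.
  move=> kM; apply/negP => MP.
  have : points_of M :|: rnc E \subset points_of P :&: K.
    by rewrite subUset CK subsetI points_ofS //; case/andP: kM => _ ->.
  move/subset_leq_card; rewrite cardsU card_kline // card_rnc //.
  have := rnc_cap_line (isT : 1 < 2) fE (kline_dim kM); have := skew_plane_card dP; lia.
have hasline H : H \in pencil P -> exists2 M, kline M & (M <= H)%VS.
  move=> /pencilP[dH PH].
  have [|[M /klinesP[]]] := set_0Vmem (klines H); last by exists M.
  case: (sect dH) => [L _ _|L1 L2 _ _ _ _|L1 L2 L3 _ _ _ _ _|L E1 _ _ _|E1 fE1 SE1] ->.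
  - by move/setP/(_ L); rewrite !inE eqxx.
  - by move/setP/(_ L1); rewrite !inE eqxx.
  - by move/setP/(_ L1); rewrite !inE eqxx.
  - by move/setP/(_ L); rewrite !inE eqxx.
  move=> _; have : rnc E \subset rnc E1 :&: points_of P.
    rewrite -SE1 subsetI; apply/andP; split; last exact: rnc_sub.
    by apply: subset_trans CK _; rewrite setSI // points_ofS.
  move/subset_leq_card; rewrite card_rnc //.
  have := @rnc_cap_le _ _ _ E1 P fE1; rewrite (_ : ~~ _); first lia.
  by apply/negP => /dimvS; rewrite dim_rowvs // dP.
have lineq H H' M : H \in pencil P -> H' \in pencil P -> kline M ->
    (M <= H)%VS -> (M <= H')%VS -> H = H'.
  move=> HP HP' kM MH MH'.
  have [p [pM pP _]] := line_avoid2 (kline_dim kM) (noP _ kM) (noP _ kM).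
  have e H1 : H1 \in pencil P -> (M <= H1)%VS -> H1 = (P + val p)%VS.
    by move=> HP1 /points_ofS/subsetP/(_ p pM) pH; apply/eqP; rewrite -pencil_add ?HP1.
  by rewrite (e H) // (e H').
have : 2 < #|pencil P| by rewrite card_pencil //; lia.
case/card_gt2P => [H1 [H2 [H3 [[h1 h2 h3] [n12 n23 n31]]]]].
have [M1 k1 MH1] := hasline _ h1; have [M2 k2 MH2] := hasline _ h2.
have [M3 k3 MH3] := hasline _ h3.
have m12 : M1 != M2.
  by apply: contra_neq n12 => e; apply: (lineq _ _ M1) => //; rewrite e.
have m23 : M2 != M3.
  by apply: contra_neq n23 => e; apply: (lineq _ _ M2) => //; rewrite e.
have m31 : M3 != M1.
  by apply: contra_neq n31 => e; apply: (lineq _ _ M3) => //; rewrite e.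
have dH : \dim (M1 + M2)%VS = 4.
  rewrite dimv_disjoint_sum ?(kline_dim k1) ?(kline_dim k2) //.
  apply/eqP; rewrite -dimv_eq0; apply: contraNT m12; rewrite -lt0n => /point_exists[p].
  by rewrite -points_ofI inE => /andP[p1 p2]; rewrite (skew k1 k2 p1 p2).
have M1H : M1 \in klines (M1 + M2)%VS by apply/klinesP; rewrite addvSl.
have M2H : M2 \in klines (M1 + M2)%VS by apply/klinesP; rewrite addvSr.
have [p pH pM] : exists2 p, p \in points_of (M1 + M2)%VS & p \in points_of M3.
  have := dim_capv_in (subvf (M1 + M2)%VS) (subvf M3); rewrite dH (kline_dim k3) dim_ambient => d.
  have [|p] := @point_exists _ _ ((M1 + M2) :&: M3)%VS; first by clear -d; lia.
  by rewrite -points_ofI inE => /andP[? ?]; exists p.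
have [R RH pR] := section_covered dH M1H M2H m12 pH (kline_sub k3 pM).
have kR : kline R by case/klinesP: RH.
move: RH; rewrite (skew kR k3 pR pM) => M3H.
have := skew_klines_le2 dH; rewrite leqNgt => /negP; apply; apply/card_gt2P.
by exists M1, M2, M3.
Qed.

End Skew.

End LinesOfK.

(** * The transversals of two meeting lines *)

Section MeetingLines.
Variables (F : finFieldType) (K : {set PG F 4}).
Local Notation vs := {vspace 'rV[F]_5}.
Local Notation q := #|F|.
Implicit Types (P H L M m n r : vs) (p : PG F 4) (X : {set PG F 4}).
Local Notation kline := (kline K).
Local Notation klines := (klines K).

Hypothesis q_ge3 : 3 <= q.
Hypothesis card_K : #|K| = q.+1 * q.+1.
Hypothesis sect : forall H, \dim H = 4 -> section_spec (points_of H :&: K) (klines H).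

(** For meeting lines m and n of K, the plane m + n turns out to have no points of K
    except those of m and n, so these are the lines meeting m or n. *)
Definition transversals m n : {set vs} :=
  [set r | [&& kline r, r != m, r != n & points_of r :&: points_of (m + n)%VS != set0]].

Lemma transversalsP m n r : reflect
  [/\ kline r, r != m, r != n & exists2 p, p \in points_of r & p \in points_of (m + n)%VS]
  (r \in transversals m n).
Proof.
rewrite inE; apply: (iffP and4P) => -[kr rm rn h]; split=> //.
  by have /set0Pn[p] := h; rewrite inE => /andP[? ?]; exists p.
by case: h => p pr pP; apply/set0Pn; exists p; rewrite inE pr.
Qed.

Lemma kline_sub_of_points r p x U : kline r -> p != x -> p \in points_of r -> x \in points_of r ->
  p \in points_of U -> x \in points_of U -> (r <= U)%VS.
Proof. by move=> /kline_dim; exact: line_through. Qed.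

Section Pair.
Variables (m n : vs) (o : PG F 4).
Hypotheses (km : kline m) (kn : kline n) (mn : m != n).
Hypotheses (om : o \in points_of m) (on : o \in points_of n).
Let P := (m + n)%VS.

Let dP : \dim P = 3.
Proof. exact: dim_add_meeting (kline_dim km) (kline_dim kn) mn om on. Qed.

Let mH H : H \in pencil P -> m \in klines H.
Proof.
case/pencilP=> _ PH; apply/klinesP; split=> //; apply: subv_trans PH; exact: addvSl.
Qed.

Let nH H : H \in pencil P -> n \in klines H.
Proof.
case/pencilP=> _ PH; apply/klinesP; split=> //; apply: subv_trans PH; exact: addvSr.
Qed.

Let in_pencil p : exists2 H, H \in pencil P & p \in points_of H.
Proof.
have [pP|pP] := boolP (p \in points_of P); last first.
  by exists (P + val p)%VS; have := eqxx (P + val p)%VS; rewrite -pencil_add // => /andP[].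
have [|H PH dH] := @superspace_of_dim _ _ P 4; first by rewrite dP.
by exists H; [apply/pencilP|move/points_ofS/subsetP: PH; apply].
Qed.

Let third H r r' : H \in pencil P -> r \in klines H -> r' \in klines H ->
  r != m -> r != n -> r' != m -> r' != n -> r = r'.
Proof.
move=> HP rH r'H rm rn r'm r'n; have [dH _] := pencilP _ _ HP.
exact: (third_kline_unique sect dH (mH HP) (nH HP) rH r'H mn rm rn r'm r'n).
Qed.

Let covered H p : H \in pencil P -> p \in points_of H -> p \in K ->
  exists2 r, r \in klines H & p \in points_of r.
Proof.
move=> HP pH pK; have [dH _] := pencilP _ _ HP.
exact: (section_covered sect dH (mH HP) (nH HP) mn pH pK).
Qed.

(** A third line r of K in the plane of m and n would lie in all hyperplanes through the
    plane, whose sections would then be m, n and r only, covering K by three lines. *)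
Lemma pair_coplanar r : kline r -> (r <= m + n)%VS -> r = m \/ r = n.
Proof.
move=> kr rP; have [rm|rm] := eqVneq r m; first by left.
have [rn|rn] := eqVneq r n; [by right|exfalso].
have : K \subset points_of m :|: points_of n :|: points_of r.
  apply/subsetP => p pK; have [H HP pH] := in_pencil p.
  have [s sH ps] := covered HP pH pK; rewrite !in_setU.
  have [<-|sm] := eqVneq s m; first by rewrite ps.
  have [<-|sn] := eqVneq s n; first by rewrite ps orbT.
  rewrite (@third H r s) ?ps ?orbT //; apply/klinesP; split=> //.
  by have [_ PH] := pencilP _ _ HP; apply: subv_trans PH.
have c s : kline s -> #|K :&: points_of s| <= q.+1.
  by move=> ks; rewrite -(card_kline ks) subset_leq_card ?subsetIr.
move/(cover3_card (c _ km) (c _ kn) (c _ kr)); rewrite card_K.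
by move: q_ge3; move: #|F| => k; clear; nia.
Qed.

Let cap_le1 r : r \in transversals m n -> #|points_of r :&: points_of P| = 1.
Proof.
case/transversalsP => kr rm rn [p pr pP]; apply/eqP; rewrite eqn_leq; apply/andP; split.
  apply: line_cap_le1; first exact: kline_dim kr.
  by apply/negP => /(pair_coplanar kr)[/eqP|/eqP]; apply/negP.
by rewrite card_gt0; apply/set0Pn; exists p; rewrite inE pr.
Qed.

(** The hyperplane spanned by the plane and p contains m, n and a third line of K,
    through p. *)
Let transversal_cover p : p \in K :\: points_of P ->
  exists2 r, r \in transversals m n & p \in points_of r.
Proof.
rewrite in_setD => /andP[pP pK].
have /andP[HP pH] : (P + val p \in pencil P)%VS && (p \in points_of (P + val p)%VS).
  by rewrite pencil_add.
have [r rH pr] := covered HP pH pK; exists r => //.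
have [kr rsub] := klinesP _ _ _ rH; have [dH PH] := pencilP _ _ HP.
have rP : ~~ (r <= P)%VS by apply: contra pP => /points_ofS/subsetP/(_ p pr).
have := cap_point_card (kline_dim kr) rsub PH.
rewrite dH dP => /(_ erefl rP) c1; apply/transversalsP; split=> //.
- by apply: contraNneq rP => ->; exact: addvSl.
- by apply: contraNneq rP => ->; exact: addvSr.
have : points_of r :&: points_of P != set0 by rewrite -card_gt0 c1.
by case/set0Pn => x; rewrite in_setI => /andP[? ?]; exists x.
Qed.

(** The hyperplane spanned by the plane and p has room for a single line besides m and
    n. *)
Lemma transversal_unique p r r' : p \notin points_of (m + n)%VS ->
  r \in transversals m n -> r' \in transversals m n ->
  p \in points_of r -> p \in points_of r' -> r = r'.
Proof.
move=> pP /transversalsP[kr rm rn [x xr xP]] /transversalsP[kr' r'm r'n [x' xr' xP']] pr pr'.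
have /andP[HP pH] : (P + val p \in pencil P)%VS && (p \in points_of (P + val p)%VS).
  by rewrite pencil_add.
have sub s y : kline s -> y \in points_of s -> y \in points_of P -> p \in points_of s ->
    s \in klines (P + val p)%VS.
  move=> ks ys yP ps; apply/klinesP; split=> //; apply: (kline_sub_of_points ks _ ps ys) => //.
    by apply: contraNneq pP => ->.
  by move: yP; rewrite !in_points => /subv_trans; apply; exact: addvSl.
exact: (third HP (sub r x kr xr xP pr) (sub r' x' kr' xr' xP' pr') rm rn r'm r'n).
Qed.

Let extra : #|(points_of P :&: K) :\: (points_of m :|: points_of n)| <= 1.
Proof.
rewrite leqNgt; apply/negP => /card_gt1P[a [b [aX bX ab]]].
have [|H PH dH] := @superspace_of_dim _ _ P 4; first by rewrite dP.
have HP : H \in pencil P by apply/pencilP.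
have on_third c : c \in (points_of P :&: K) :\: (points_of m :|: points_of n) ->
    exists r, [/\ r \in klines H, r != m, r != n, c \in points_of r & c \in points_of P].
  rewrite in_setD in_setU negb_or in_setI => /andP[/andP[cm cn] /andP[cP cK]].
  have cH : c \in points_of H by move/points_ofS/subsetP: PH; apply.
  have [r rH cr] := covered HP cH cK; exists r; split=> //.
    by apply: contraNneq cm => <-.
  by apply: contraNneq cn => <-.
have [r [rH rm rn ar aP]] := on_third a aX; have [s [sH sm sn bs bP]] := on_third b bX.
rewrite (third HP sH rH sm sn rm rn) in bs; have [kr _] := klinesP _ _ _ rH.
case: (pair_coplanar kr (kline_sub_of_points kr ab ar bs aP bP)) => /eqP; exact/negP.
Qed.

Let cap_mn : #|points_of m :&: points_of n| = 1.
Proof.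
apply/eqP; rewrite eqn_leq line_cap_line ?(kline_dim km) ?(kline_dim kn) //=.
by rewrite card_gt0; apply/set0Pn; exists o; rewrite in_setI om.
Qed.

(** The transversals partition the points of K off the plane of m and n into sets of q
    points; the plane itself has 2q + 1 points of m and n, and the extra ones. *)
Let count : q * q = #|(points_of P :&: K) :\: (points_of m :|: points_of n)|
  + #|transversals m n| * q.
Proof.
have cKP : #|K :\: points_of P| = #|transversals m n| * q.
  rewrite (partition_card transversal_cover).
    rewrite -sum_nat_const; apply: eq_bigr => r rR; have c1 := cap_le1 rR.
    have /transversalsP[kr _ _ _] := rR.
    have -> : (K :\: points_of P) :&: points_of r = points_of r :\: points_of P.
      apply/setP => x; rewrite !in_setI !in_setD andbC; case xr: (x \in points_of r); rewrite ?andbF //=.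
      by rewrite (kline_sub kr xr) andbT.
    by rewrite cardsD c1 (card_kline kr) subn1.
  move=> p r r'; rewrite in_setD => /andP[pP _]; exact: transversal_unique.
have mnP : points_of m :|: points_of n \subset points_of P :&: K.
  rewrite subUset !subsetI !points_ofS ?addvSl ?addvSr //=.
  by case/andP: km => _ ->; case/andP: kn.
have := cardsID (points_of P) K; rewrite cKP card_K setIC.
rewrite cardsD (setIidPr mnP) cardsU cap_mn (card_kline km) (card_kline kn).
have : #|points_of m :|: points_of n| <= #|points_of P :&: K| by exact: subset_leq_card.
rewrite cardsU cap_mn (card_kline km) (card_kline kn); move: #|F| (#|_ :&: _|) (#|transversals m n|) => k x t.
by clear; nia.
Qed.

(** There is at most one extra point, and q divides the number of extra points. *)
Let no_extra : #|(points_of P :&: K) :\: (points_of m :|: points_of n)| = 0.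
Proof.
have := modnMr q q; rewrite count addnC modnMDl modn_small //.
by apply: leq_ltn_trans extra _; apply: ltnW.
Qed.

Lemma pair_plane p : p \in points_of (m + n)%VS -> p \in K -> p \in points_of m \/ p \in points_of n.
Proof.
move=> pP pK; apply/orP; rewrite -in_setU; apply: contraTT isT => pmn /=.
have := cards0_eq no_extra; move/setP/(_ p).
by rewrite in_setD pmn in_setI pP pK inE.
Qed.

Lemma card_transversals : #|transversals m n| = q.
Proof.
have := count; rewrite no_extra add0n => /esym/eqP; rewrite eqn_pmul2r => [/eqP//|].
by apply: leq_trans q_ge3.
Qed.

Lemma pair_cover p : p \in K -> [\/ p \in points_of m, p \in points_of n |
  exists2 r, r \in transversals m n & p \in points_of r].
Proof.
move=> pK; have [pP|pP] := boolP (p \in points_of P).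
  by case: (pair_plane pP pK); [constructor 1|constructor 2].
by constructor 3; apply: transversal_cover; rewrite in_setD pP.
Qed.

Lemma transversal_meets r : r \in transversals m n ->
  exists2 p, p \in points_of r & p \in points_of m \/ p \in points_of n.
Proof.
case/transversalsP => kr _ _ [p pr pP]; exists p => //.
exact: pair_plane pP (kline_sub kr pr).
Qed.

End Pair.

(** The pair (m, r1) has q transversals, and r2, disjoint from m and r1, is not among
    them; but they would have to cover the q + 1 points of r2, at most one point each. *)
Lemma transversals_same_side m n o r1 r2 : kline m -> kline n -> m != n ->
  o \in points_of m -> o \in points_of n ->
  r1 \in transversals m n -> r2 \in transversals m n ->
  [disjoint points_of r1 & points_of n] -> [disjoint points_of r2 & points_of m] -> False.
Proof.
move=> km kn mn om on r1R r2R r1n r2m.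
have nin (A B : {set PG F 4}) p : [disjoint A & B] -> p \in A -> p \in B -> False.
  by move=> /pred0P/(_ p) /= => h pA pB; rewrite pA pB in h.
have [x x1 xmn] := transversal_meets km kn mn om on r1R.
have xm : x \in points_of m by case: xmn => // xn; case: (nin _ _ _ r1n x1 xn).
have [y y2 ymn] := transversal_meets km kn mn om on r2R.
have yn : y \in points_of n by case: ymn => // ym; case: (nin _ _ _ r2m y2 ym).
have [k1 r1m _ _] := transversalsP _ _ _ r1R; have [k2 _ _ _] := transversalsP _ _ _ r2R.
have d12 p : p \in points_of r1 -> p \in points_of r2 -> False.
  move=> p1 p2; have [pP|pP] := boolP (p \in points_of (m + n)%VS).
    case: (pair_plane km kn mn om on pP (kline_sub k1 p1)) => pz.
      exact: nin r2m p2 pz.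
    exact: nin r1n p1 pz.
  have e := transversal_unique km kn mn om on pP r1R r2R p1 p2.
  by rewrite e in r1n; exact: nin r1n y2 yn.
have mr1 : m != r1 by rewrite eq_sym.
have r2n : r2 \notin transversals m r1.
  apply/negP => /(transversal_meets km k1 mr1 xm x1)[p p2 [pm|p1]].
    exact: nin r2m p2 pm.
  exact: d12 p1 p2.
have : #|points_of r2| <= #|transversals m r1|.
  apply: cover_le => [p p2|r rR].
    case: (pair_cover km k1 mr1 xm x1 (kline_sub k2 p2)) => // pz.
      by case: (nin _ _ _ r2m p2 pz).
    by case: (d12 p pz p2).
  have [kr _ _ _] := transversalsP _ _ _ rR.
  apply: line_cap_line; [exact: kline_dim k2|exact: kline_dim kr|].
  by apply: contraNneq r2n => ->.
by rewrite (card_transversals km k1 mr1 xm x1) (card_kline k2) ltnn.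
Qed.

(** That the lines of G are pairwise disjoint, and cover K without m, is a consequence
    of the hypotheses on the sections. *)
Definition directrix m (G : {set vs}) : Prop :=
  [/\ kline m, #|G| = q.+1,
      forall g, g \in G -> [/\ kline g, g != m & exists2 p, p \in points_of g & p \in points_of m] &
      forall p, p \in K -> p \in points_of m \/ exists2 g, g \in G & p \in points_of g].

Lemma directrix_of_pair m n o : kline m -> kline n -> m != n ->
  o \in points_of m -> o \in points_of n ->
  (forall r, r \in transversals m n -> exists2 p, p \in points_of r & p \in points_of m) ->
  directrix m (n |: transversals m n).
Proof.
move=> km kn mn om on meets; split=> //.
- rewrite cardsU1 (card_transversals km kn mn om on).
  by rewrite (_ : n \notin _) //; apply/negP => /transversalsP[_ _ /eqP].
- move=> g; rewrite in_setU1 => /orP[/eqP->|gR].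
    by split=> //; [rewrite eq_sym|exists o].
  by have [kg gm _ _] := transversalsP _ _ _ gR; split=> //; apply: meets.
move=> p /(pair_cover km kn mn om on)[pm|pn|[r rR pr]]; [by left|right|right].
  by exists n; rewrite ?setU11.
by exists r; rewrite // in_setU1 rR orbT.
Qed.

(** By [transversals_same_side], one of two meeting lines meets all the transversals of
    the pair; the other line and the transversals form the family. *)
Lemma exists_directrix : exists m G, directrix m G.
Proof.
pose meet L M := [exists p, (p \in points_of L) && (p \in points_of M)].
have [/existsP[m /existsP[n /and4P[km kn mn /existsP[o /andP[om on]]]]]|] :=
  boolP [exists m, exists n, [&& kline m, kline n, m != n & meet m n]]; last first.
  rewrite negb_exists => /forallP skew; case: (not_skew q_ge3 sect card_K).
  move=> L M p kL kM pL pM; apply/eqP; apply: contraTT isT => LM /=.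
  have := skew L; rewrite negb_exists => /forallP/(_ M); rewrite kL kM LM /= => /negP[].
  by apply/existsP; exists p; rewrite pL.
have [/forall_inP all_m|] := boolP [forall r in transversals m n, meet r m].
  exists m, (n |: transversals m n); apply: (directrix_of_pair km kn mn om on) => r rR.
  by have /existsP[p /andP[? ?]] := all_m r rR; exists p.
rewrite negb_forall_in => /exists_inP[r2 r2R r2m].
exists n, (m |: transversals n m); apply: (directrix_of_pair (o := o)); rewrite // 1?eq_sym //.
move=> r rR; have {}rR : r \in transversals m n.
  have [kr rn rm h] := transversalsP _ _ _ rR.
  by apply/transversalsP; split=> //; rewrite addvC.
have [/existsP[p /andP[? ?]]|rn] := boolP (meet r n); first by exists p.
have dis s z : ~~ meet s z -> [disjoint points_of s & points_of z].
  rewrite negb_exists => /forallP h; apply/pred0P => p /=; exact/negbTE/h.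
by case: (transversals_same_side km kn mn om on rR r2R (dis _ _ rn) (dis _ _ r2m)).
Qed.

End MeetingLines.

(** * The directrix and its generators *)

Section Directrix.
Variables (F : finFieldType) (K : {set PG F 4}).
Local Notation vs := {vspace 'rV[F]_5}.
Local Notation q := #|F|.
Implicit Types (P H L M g r : vs) (p x y : PG F 4) (X Z : {set PG F 4}).
Local Notation kline := (kline K).
Local Notation klines := (klines K).

Hypothesis q_ge3 : 3 <= q.
Hypothesis card_K : #|K| = q.+1 * q.+1.
Hypothesis sect : forall H, \dim H = 4 -> section_spec (points_of H :&: K) (klines H).

Variables (m : vs) (G : {set vs}).
Hypothesis mG : directrix K m G.

Let km : kline m. Proof. by case: mG. Qed.
Let cG : #|G| = q.+1. Proof. by case: mG. Qed.

Lemma gen_kline g : g \in G -> kline g.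
Proof. by case: mG => _ _ h _ /h[]. Qed.

Lemma gen_meet g : g \in G -> exists2 p, p \in points_of g & p \in points_of m.
Proof. by case: mG => _ _ h _ /h[]. Qed.

Lemma gen_neq g : g \in G -> g != m.
Proof. by case: mG => _ _ h _ /h[]. Qed.

Let gen_cover p : p \in K -> p \notin points_of m -> exists2 g, g \in G & p \in points_of g.
Proof. by case: mG => _ _ _ h /h[->|]. Qed.

Let gen_cap_m g : g \in G -> #|points_of m :&: points_of g| = 1.
Proof.
move=> gG; have [y yg ym] := gen_meet gG; apply/eqP; rewrite eqn_leq; apply/andP; split.
  by rewrite line_cap_line ?(kline_dim km) ?(kline_dim (gen_kline gG)) // eq_sym gen_neq.
by rewrite card_gt0; apply/set0Pn; exists y; rewrite in_setI ym.
Qed.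

(** Two generators meeting off m would be coplanar with m. *)
Let gen_share p g g' : g \in G -> g' \in G -> p \in points_of g -> p \in points_of g' ->
  p \notin points_of m -> g = g'.
Proof.
move=> gG g'G pg pg' pm; have [y yg ym] := gen_meet gG; have [z zg' zm] := gen_meet g'G.
have pz : p != z by apply: contraNneq pm => ->.
have mg : m != g by rewrite eq_sym gen_neq.
have sup : (g' <= m + g)%VS.
  apply: (kline_sub_of_points (gen_kline g'G) pz pg' zg').
    by move: pg; rewrite !in_points => /subv_trans; apply; exact: addvSr.
  by move: zm; rewrite !in_points => /subv_trans; apply; exact: addvSl.
case: (pair_coplanar q_ge3 card_K sect km (gen_kline gG) mg ym yg (gen_kline g'G) sup) => // e.
by have := gen_neq g'G; rewrite e eqxx.
Qed.

Lemma hyperplane_cap_line H L : \dim H = 4 -> \dim L = 2 -> ~~ (L <= H)%VS ->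
  #|points_of L :&: points_of H| = 1.
Proof.
by move=> dH dL LH; apply: (cap_point_card dL (subvf L) (subvf H)); rewrite ?dim_ambient ?dH.
Qed.

(** K is the disjoint union of m and the generators deprived of their points on m. *)
Let hyper_count H : \dim H = 4 -> ~~ (m <= H)%VS ->
  #|points_of H :&: K| = 1 + \sum_(g in G) #|(points_of g :&: points_of H) :\: points_of m|.
Proof.
move=> dH mH; rewrite -(cardsID (points_of m)).
have -> : points_of H :&: K :&: points_of m = points_of m :&: points_of H.
  apply/setP => x; rewrite !in_setI; case xm: (x \in points_of m); rewrite ?andbF //=.
  by rewrite (kline_sub km xm) !andbT.
rewrite hyperplane_cap_line ?(kline_dim km) //; congr (1 + _).
rewrite (@partition_card _ _ G) => [|x|x g g'].
- apply: eq_bigr => g gG; apply: eq_card => x; rewrite !(in_setI, in_setD).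
  case xg: (x \in points_of g); rewrite ?andbF //= andbT.
  by rewrite (kline_sub (gen_kline gG) xg) andbT.
- by rewrite !(in_setI, in_setD) => /and3P[xm _ xK]; apply: gen_cover.
rewrite in_setD => /andP[xm _] gG g'G xg xg'; exact: gen_share xg xg' xm.
Qed.

(** Suppose that no generator passes through p. A hyperplane meeting m in p only then
    contains no generator, so it has p and one point of each generator: q + 2 points of
    K, which is neither q + 1 nor at least 2q. *)
Lemma gen_through p : p \in points_of m -> exists2 g, g \in G & p \in points_of g.
Proof.
move=> pm; have [/exists_inP//|] := boolP [exists g in G, p \in points_of g].
rewrite negb_exists_in => /forall_inP no.
have [p' p'm pp'] : exists2 p', p' \in points_of m & p' \notin points_of (val p).
  apply/subsetPn; apply/negP => /subset_leq_card.
  rewrite (card_kline km) points_of_point cards1.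
  by move: q_ge3; move: #|F| => k; clear; lia.
have [H [dH pH p'H]] := hyperplane_avoid pp'.
have mH : ~~ (m <= H)%VS by apply: contra p'H => /points_ofS/subsetP/(_ _ p'm).
have onlyp y : y \in points_of m -> y \in points_of H -> y = p.
  move=> ym yH; apply/eqP; apply: contraNT mH => yp.
  by apply: (kline_sub_of_points km yp ym pm yH); rewrite in_points.
have E : #|points_of H :&: K| = q.+2.
  rewrite (hyper_count dH mH) -cG -sum1_card; congr (1 + _); apply: eq_bigr => g gG.
  have [y yg ym] := gen_meet gG.
  have gH : ~~ (g <= H)%VS.
    apply: contra (no _ gG) => /points_ofS/subsetP/(_ _ yg) yH.
    by rewrite -(onlyp y ym yH).
  rewrite (setDidPl _) ?(hyperplane_cap_line dH (kline_dim (gen_kline gG)) gH) //.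
  apply/pred0P => x /=; rewrite in_setI; apply/negbTE/negP => /andP[/andP[xg xH] xm].
  by have := no _ gG; rewrite -(onlyp x xm xH) xg.
have := section_card q_ge3 sect dH; rewrite E; move: q_ge3; move: #|F| => k; clear; lia.
Qed.

(** There are q + 1 generators, each meeting m in one point, and each of the q + 1 points
    of m is on a generator; so it is on only one. *)
Lemma gen_disjoint p g g' : g \in G -> g' \in G -> p \in points_of g -> p \in points_of g' ->
  g = g'.
Proof.
move=> gG g'G pg pg'; have [pm|] := boolP (p \in points_of m); last exact: gen_share.
have c1 y : y \in points_of m -> 1 <= #|[set g in G | y \in points_of g]|
    ?= iff (#|[set g in G | y \in points_of g]| == 1).
  move=> /gen_through[h hG yh]; split; last by rewrite eq_sym.
  by rewrite card_gt0; apply/set0Pn; exists h; rewrite inE hG.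
have /leqifP := leqif_sum c1; case: ifP => [/forall_inP/(_ p pm)/eqP e1 _|_].
  apply/eqP; apply: contraTT isT => gg'.
  have : [set g; g'] \subset [set g in G | p \in points_of g].
    by apply/subsetP => h /set2P[]->; rewrite inE ?gG ?g'G.
  by move/subset_leq_card; rewrite e1 cards2 gg'.
rewrite -sum_incidence (eq_bigr _ (fun g gG => gen_cap_m gG)) !sum1_card cG.
by rewrite (card_kline km) ltnn.
Qed.

Lemma point_gen p : p \in K -> exists2 g, g \in G & p \in points_of g.
Proof.
move=> pK; have [/gen_through//|pm] := boolP (p \in points_of m); exact: gen_cover.
Qed.

Let gens_in_hyperplane H : \dim H = 4 -> (m <= H)%VS -> #|[set g in G | (g <= H)%VS]| <= 2.
Proof.
move=> dH mH; have : m |: [set g in G | (g <= H)%VS] \subset klines H.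
  apply/subsetP => g; rewrite in_setU1 inE => /orP[/eqP->|/andP[gG gH]]; apply/klinesP => //.
  by split=> //; apply: gen_kline.
move/subset_leq_card/leq_trans/(_ (klines_le3 sect dH)).
rewrite cardsU1 inE (_ : m \in G = false) //=.
by apply/negbTE/negP => /gen_neq; rewrite eqxx.
Qed.

Section ConicSection.
Variables (H g0 : vs).
Hypotheses (dH : \dim H = 4) (g0G : g0 \in G) (g0H : (g0 <= H)%VS) (mH : ~~ (m <= H)%VS).

Let m_on_g0 x : x \in points_of m -> x \in points_of H -> x \in points_of g0.
Proof.
move=> xm xH; have [y yg ym] := gen_meet g0G.
have yH : y \in points_of H by move/points_ofS/subsetP: g0H; apply.
suff -> : x = y by [].
by apply/eqP; apply: contraNT mH => xy; apply: (kline_sub_of_points km xy).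
Qed.

Let gen_in_H g : g \in G -> (g <= H)%VS -> g = g0.
Proof.
move=> gG gH; have [y yg ym] := gen_meet gG.
have yH : y \in points_of H by move/points_ofS/subsetP: gH; apply.
exact: gen_disjoint gG g0G yg (m_on_g0 ym yH).
Qed.

Let gen_cap_H g : g \in G -> g != g0 -> #|points_of g :&: points_of H| = 1.
Proof.
move=> gG gg0; apply: hyperplane_cap_line; rewrite // ?(kline_dim (gen_kline gG)) //.
by apply: contra gg0 => /(gen_in_H gG) ->.
Qed.

(** The generator through a point of Z lies in the span of m and W. These generators are
    distinct, and a hyperplane through m contains at most two of them. *)
Let few Z W : Z \subset (points_of H :&: K) :\: points_of g0 -> Z \subset points_of W ->
  \dim (m + W)%VS <= 4 -> #|Z| <= 2.
Proof.
move=> ZH ZW dW; have [|H' sub dH'] := @superspace_of_dim _ _ (m + W)%VS 4; first by rewrite dW.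
have mH' : (m <= H')%VS by apply: subv_trans sub; exact: addvSl.
apply: leq_trans (gens_in_hyperplane dH' mH'); apply: cover_le => [x xZ|g].
  have := subsetP ZH x xZ; rewrite in_setD in_setI => /andP[xg0 /andP[xH xK]].
  have xm : x \notin points_of m by apply: contra xg0 => xm; apply: m_on_g0.
  have [g gG xg] := gen_cover xK xm; exists g => //; rewrite inE gG.
  have [y yg ym] := gen_meet gG; apply: (kline_sub_of_points (gen_kline gG) _ xg yg).
  - by apply: contraNneq xm => ->.
  - have := subsetP ZW x xZ; rewrite !in_points => xW.
    by apply: subv_trans xW _; apply: subv_trans sub; exact: addvSr.
  - by move: ym; rewrite !in_points => /subv_trans; apply.
rewrite inE => /andP[gG _]; have [->|gg0] := eqVneq g g0.
  rewrite (_ : Z :&: _ = set0) ?cards0 //; apply/setP => x; rewrite in_setI in_set0.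
  by apply/negbTE/negP => /andP[/(subsetP ZH)]; rewrite in_setD => /andP[/negP].
apply: (@leq_trans #|points_of g :&: points_of H|); last by rewrite gen_cap_H.
apply: subset_leq_card; rewrite subsetI subsetIr /=.
apply/subsetP => x; rewrite in_setI => /andP[/(subsetP ZH)].
by rewrite in_setD in_setI => /andP[_ /andP[]].
Qed.

(** A second line of K in H would meet at least q >= 3 generators in points off g0. *)
Let only_line s : s \in klines H -> s = g0.
Proof.
case/klinesP => ks sH; apply/eqP; apply: contraTT isT => sg0 /=.
have : #|points_of s :\: points_of g0| <= 2.
  apply: (@few _ s); last 2 first.
  - exact: subsetDl.
  - have := dimv_sum_cap m s; rewrite (kline_dim km) (kline_dim ks) => e.
    by move: (leq_addr (\dim (m :&: s)%VS) (\dim (m + s)%VS)); rewrite e.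
  by rewrite setSD // subsetI points_ofS //; case/andP: ks.
rewrite cardsD (card_kline ks).
have := line_cap_line (kline_dim ks) (kline_dim (gen_kline g0G)) sg0.
by move: q_ge3; move: #|F| (#|_ :&: _|) => k c; clear; lia.
Qed.

(** All q + 1 points of g0, and one point of each of the other q generators. *)
Let section_size : #|points_of H :&: K| = 2 * q + 1.
Proof.
rewrite hyper_count // (bigD1 g0) //=.
rewrite (setIidPl (points_ofS g0H)) cardsD setIC (gen_cap_m g0G) (card_kline (gen_kline g0G)).
rewrite (eq_bigr (fun=> 1)) => [|g /andP[gG gg0]].
  have := cG; rewrite -sum1_card (bigD1 g0) //= add1n => -[->].
  by move: #|F| => k; clear; lia.
rewrite (setDidPl _) ?gen_cap_H //.
apply/pred0P => x /=; rewrite in_setI; apply/negbTE/negP => /andP[/andP[xg xH] xm].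
by have e := gen_disjoint gG g0G xg (m_on_g0 xm xH); rewrite e eqxx in gg0.
Qed.

(** The section has 2q + 1 points and g0 is its only line, so it is the union of g0 and a
    conic sharing one point with g0; hence the conic has a point on each generator. If
    its plane met m, the q generators through points of the conic off g0 would lie in a
    hyperplane with m. *)
Lemma conic_section : exists E : 'M[F]_(3, 5), [/\ row_free E, (rowvs E <= H)%VS,
  points_of H :&: K = points_of g0 :|: rnc E,
  forall g, g \in G -> exists2 x, x \in rnc E & x \in points_of g &
  (m :&: rowvs E = 0)%VS].
Proof.
case: (sect dH) => [L dL SE _|L1 L2 d1 d2 n12 SE LE|L1 L2 L3 d1 d2 d3 /and3P[n12 n13 n23] SE LE|L E dL fE SE LE|E fE SE LE].
- by have := section_size; rewrite SE (card_line dL); move: q_ge3; move: #|F| => k; clear; lia.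
- have e1 : L1 = g0 by apply: only_line; rewrite LE !inE eqxx.
  have e2 : L2 = g0 by apply: only_line; rewrite LE !inE eqxx orbT.
  by rewrite e1 e2 eqxx in n12.
- have e1 : L1 = g0 by apply: only_line; rewrite LE !inE eqxx.
  have e2 : L2 = g0 by apply: only_line; rewrite LE !inE eqxx orbT.
  by rewrite e1 e2 eqxx in n12.
- have Lg0 : L = g0 by apply: only_line; rewrite LE inE.
  have kg0 := gen_kline g0G; rewrite {}Lg0 in SE LE.
  have c0 : #|points_of g0 :&: rnc E| = 1.
    have := section_size; rewrite SE cardsU card_rnc // (card_kline kg0).
    have := rnc_cap_line (isT : 1 < 2) fE (kline_dim kg0).
    by move: q_ge3; move: #|F| (#|_ :&: _|) => k c; clear; lia.
  have EH : rnc E \subset points_of H :&: K by rewrite SE subsetUr.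
  have PH : (rowvs E <= H)%VS.
    apply: contraTT isT => /(rnc_cap_le fE).
    rewrite (setIidPl _) ?card_rnc //; last by apply: subset_trans EH (subsetIl _ _).
    by move: q_ge3; move: #|F| => k; clear; lia.
  exists E; split=> //.
  + move=> g gG; have [->|gg0] := eqVneq g g0.
      have : 0 < #|points_of g0 :&: rnc E| by rewrite c0.
      by rewrite card_gt0 => /set0Pn[x]; rewrite in_setI => /andP[? ?]; exists x.
    have : 0 < #|points_of g :&: points_of H| by rewrite gen_cap_H.
    rewrite card_gt0 => /set0Pn[x]; rewrite in_setI => /andP[xg xH]; exists x => //.
    have : x \in points_of H :&: K by rewrite in_setI xH (kline_sub (gen_kline gG) xg).
    rewrite SE in_setU => /orP[xg0|//].
    by have e := gen_disjoint gG g0G xg xg0; rewrite e eqxx in gg0.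
  + apply/eqP; rewrite -dimv_eq0; apply: contraTT isT; rewrite -lt0n => d0.
    have : #|rnc E :\: points_of g0| <= 2.
      apply: (@few _ (rowvs E)).
      * by rewrite setSD.
      * by apply: subset_trans (subsetDl _ _) (rnc_sub fE).
      * have := dimv_sum_cap m (rowvs E); rewrite (kline_dim km) dim_rowvs //.
        by move: d0; move: (\dim _) (\dim _) => a b; clear; lia.
    rewrite cardsD setIC c0 card_rnc //.
    by move: q_ge3; move: #|F| => k; clear; lia.
- by have := section_size; rewrite SE card_rnc //; move: q_ge3; move: #|F| => k; clear; lia.
Qed.

End ConicSection.

End Directrix.

(** * Coordinates for the directrix and a conic *)

Section Coordinates.
Variable F : finFieldType.
Local Notation vs := {vspace 'rV[F]_5}.
Local Notation q := #|F|.
Implicit Types (u v : 'rV[F]_2) (M : 'M[F]_(2, 5)) (E : 'M[F]_(3, 5)).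
Local Open Scope ring_scope.

Definition frame M E : 'M[F]_5 := col_mx M E.

Lemma line_vec_frame M E u : line_vec u *m frame M E = u *m M.
Proof. by rewrite /line_vec /frame (mul_row_col u 0 M E) mul0mx addr0. Qed.

Lemma conic_vec_frame M E v : conic_vec v *m frame M E = veronese 2 v *m E.
Proof. by rewrite /conic_vec /frame (mul_row_col 0 _ M E) mul0mx add0r. Qed.

Lemma complementary_decomp M E (x x' : 'rV[F]_2) (y y' : 'rV[F]_3) : row_free M -> row_free E ->
  (rowvs M :&: rowvs E = 0)%VS -> x *m M + y *m E = x' *m M + y' *m E -> x = x' /\ y = y'.
Proof.
move=> fM fE ME0 e.
have e' : (x - x') *m M = (y' - y) *m E.
  by apply/eqP; rewrite !mulmxBl subr_eq addrAC -subr_eq opprK e addrC.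
have : (x - x') *m M \in (rowvs M :&: rowvs E)%VS.
  by rewrite memv_cap mem_rowvs e' mem_rowvs.
rewrite ME0 memv0 => /eqP z; split.
  by apply/eqP; rewrite -subr_eq0; apply/eqP/(row_free_inj fM); rewrite z mul0mx.
apply/esym/eqP; rewrite -subr_eq0; apply/eqP/(row_free_inj fE).
by rewrite -e' z mul0mx.
Qed.

Lemma frame_unit M E : row_free M -> row_free E ->
  (rowvs M :&: rowvs E = 0)%VS -> frame M E \in unitmx.
Proof.
move=> fM fE ME0; rewrite -row_free_unit; apply: inj_row_free => w.
move: w (hsubmxK (w : 'rV_(2 + 3))) => w <-.
move: (lsubmx _) (rsubmx _) => x y.
have -> : row_mx x y *m frame M E = x *m M + y *m E by exact: mul_row_col.
move=> e; have {}e : x *m M + y *m E = 0 *m M + 0 *m E by rewrite e !mul0mx addr0.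
by have [-> ->] := complementary_decomp fM fE ME0 e; exact: (row_mx0 F 1 2 3).
Qed.

Lemma veronese_inj d k v v' : (0 < d)%N -> v != 0 -> v' != 0 ->
  veronese d v' = k *: veronese d v -> exists2 c, c != 0 & v' = c *: v.
Proof.
move=> d0 /par_repr[c [o [c0 ->]]] /par_repr[c' [o' [c'0 ->]]].
rewrite !veroneseZ => e.
have /(veronese_par_inj d0) -> : veronese d (par o') = (c' ^+ d)^-1 * k * c ^+ d *: veronese d (par o).
  by rewrite -!scalerA -e scalerA mulVf ?scale1r // expf_neq0.
by exists (c' / c); rewrite ?mulf_neq0 ?invr_eq0 // scalerA divfK.
Qed.

Lemma par_inj k o o' : par o = k *: par o' :> 'rV[F]_2 -> o = o'.
Proof. by move=> e; apply: (@veronese_par_inj _ 1 k); rewrite // !veronese1. Qed.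

(** The columns of L are binary quadratic forms vanishing at v1 = (x, y), so each is
    divisible by the linear form y s - x t; the columns of D are the quotients. *)
Lemma quadratic_factor k (L : 'M[F]_(3, k)) v1 : v1 != 0 -> veronese 2 v1 *m L = 0 ->
  exists D : 'M[F]_(2, k), forall v,
    veronese 2 v *m L = (v1 0 1 * v 0 0 - v1 0 0 * v 0 1) *: (v *m D).
Proof.
move=> v10 vL.
have LE v j : (veronese 2 v *m L) 0 j =
    v 0 0 ^+ 2 * L 0 j + v 0 0 * v 0 1 * L 1 j + v 0 1 ^+ 2 * L ord_max j.
  by rewrite mxE sum3 !veronese2E.
have DE (D : 'M[F]_(2, k)) v j : (v *m D) 0 j = v 0 0 * D 0 j + v 0 1 * D 1 j.
  by rewrite mxE sum2.
have vL0 j := LE v1 j; rewrite vL in vL0.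
have [b0|b0] := eqVneq (v1 0 1) 0.
  have a0 : v1 0 0 != 0.
    apply: contraNneq v10 => a0; rewrite [v1]row2E a0 b0.
    by apply/eqP/rowP => i; rewrite !mxE if_same.
  exists (\matrix_(i, j) (- (if i == 0 then L 1 j else L ord_max j) / v1 0 0)) => v.
  apply/rowP => j; rewrite [RHS]mxE DE LE !mxE /= b0.
  have : L 0 j = 0; last by move=> ->; field.
  have := vL0 j; rewrite mxE b0 mulr0 mul0r expr0n /= mul0r !addr0 => /esym/eqP.
  by rewrite mulf_eq0 sqrf_eq0 (negPf a0) => /eqP.
exists (\matrix_(i, j) (if i == 0 then L 0 j / v1 0 1
                        else (L 1 j + v1 0 0 * (L 0 j / v1 0 1)) / v1 0 1)) => v.
apply/rowP => j; rewrite [RHS]mxE DE LE !mxE /=.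
have -> : L ord_max j = - (v1 0 0 ^+ 2 * L 0 j + v1 0 0 * v1 0 1 * L 1 j) / v1 0 1 ^+ 2.
  apply: (mulIf (expf_neq0 2 b0)); rewrite divfK ?expf_neq0 // mulrC.
  by apply/eqP; rewrite -addr_eq0 addrC -vL0 mxE.
by field.
Qed.

(** The linear form used to factor quadratic forms vanishes at the point a only. *)
Lemma det_vanish (a : 'rV[F]_2) v : a != 0 -> a 0 1 * v 0 0 - a 0 0 * v 0 1 = 0 -> v \in <[a]>%VS.
Proof.
move=> a0 e; apply/vlineP; have [a00|a00] := eqVneq (a 0 0) 0.
  have a01 : a 0 1 != 0.
    apply: contraNneq a0 => a01; rewrite [a]row2E a00 a01.
    by apply/eqP/rowP => i; rewrite !mxE if_same.
  move: e; rewrite a00 mul0r subr0 => /eqP; rewrite mulf_eq0 (negPf a01) => /eqP v0.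
  exists (v 0 1 / a 0 1); rewrite [v]row2E [a]row2E a00 v0.
  by apply/rowP => i; rewrite !mxE; case: ifP; rewrite ?mulr0 // divfK.
exists (v 0 0 / a 0 0); rewrite [v]row2E [a]row2E.
apply/rowP => i; rewrite !mxE; case: ifP => _; rewrite ?divfK //=.
move/eqP: e; rewrite subr_eq0 => /eqP e.
by apply: (mulIf a00); rewrite mulrAC divfK // mulrC -e mulrC.
Qed.

End Coordinates.

(** The correspondence given by the generators between the line spanned by the rows of M
    and the conic with frame E, in terms of the parameters of the points. *)
Definition same_generator (F : finFieldType) (G : {set {vspace 'rV[F]_5}})
    (M : 'M[F]_(2, 5)) (E : 'M[F]_(3, 5)) (u v : 'rV[F]_2) : Prop :=
  exists g, [/\ g \in G, (u *m M)%R \in g & (veronese 2 v *m E)%R \in g].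

Section Scroll.
Variables (F : finFieldType) (K : {set PG F 4}).
Local Notation vs := {vspace 'rV[F]_5}.
Local Notation q := #|F|.
Local Open Scope ring_scope.
Implicit Types (u v : 'rV[F]_2) (w : 'rV[F]_5) (g H : vs) (p : PG F 4).

Hypothesis q_ge3 : (3 <= q)%N.
Hypothesis card_K : #|K| = (q.+1 * q.+1)%N.
Hypothesis sect : forall H, \dim H = 4%N -> section_spec (points_of H :&: K) (klines K H).

Variables (m : vs) (G : {set vs}).
Hypothesis mG : directrix K m G.

Let km : kline K m. Proof. by case: mG. Qed.
Let dm : \dim m = 2%N. Proof. exact: kline_dim km. Qed.
Let gk g : g \in G -> kline K g. Proof. exact: gen_kline mG g. Qed.
Let gd g : g \in G -> \dim g = 2%N. Proof. by move/gk/kline_dim. Qed.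

Let disj w g g' : g \in G -> g' \in G -> w != 0 -> w \in g -> w \in g' -> g = g'.
Proof.
move=> gG g'G /vec_PG[p pw] wg wg'.
by apply: (gen_disjoint q_ge3 card_K sect mG (p := p)); rewrite // in_points pw -memvE.
Qed.

Let gen_at_m w : w != 0 -> w \in m -> exists2 g, g \in G & w \in g.
Proof.
move=> /vec_PG[p pw] wm; have [|g gG pg] := gen_through q_ge3 card_K sect mG (p := p).
  by rewrite in_points pw -memvE.
by exists g; rewrite // memvE -pw -in_points.
Qed.

Let meet_m g : g \in G -> exists w, [/\ w != 0, w \in g & w \in m].
Proof.
case/(gen_meet mG) => p; have [w w0 pw] := PG_vec p; rewrite !in_points pw -!memvE.
by exists w.
Qed.

Let span2 L w w' : \dim L = 2%N -> w \in L -> w' \in L -> w != 0 -> w' \notin <[w]>%VS ->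
  (<[w]> + <[w']>)%VS = L :> vs.
Proof.
move=> dL wL w'L w0 w'w; apply/eqP; rewrite eqEdim subv_add -!memvE wL w'L dL /=.
have [p pw] : exists p : PG F 4, val p = <[w']>%VS.
  by apply: vec_PG; apply: contraNneq w'w => ->; exact: mem0v.
by rewrite -pw dim_add_point ?dim_vline ?w0 // in_points pw -memvE.
Qed.

Section Frame.
Variables (M : 'M[F]_(2, 5)) (E : 'M[F]_(3, 5)) (g0 H : vs).
Hypotheses (fM : row_free M) (rM : rowvs M = m) (fE : row_free E).
Hypotheses (dH : \dim H = 4%N) (g0G : g0 \in G) (g0H : (g0 <= H)%VS) (mH : ~~ (m <= H)%VS).
Hypothesis EH : (rowvs E <= H)%VS.
Hypothesis mE0 : (m :&: rowvs E = 0)%VS.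
Hypothesis EK : rnc E \subset K.
Hypothesis EG : forall g, g \in G -> exists2 x, x \in rnc E & x \in points_of g.

Local Notation rel := (same_generator G M E).

Let uM0 u : u != 0 -> u *m M != 0. Proof. exact: mulmx_free_neq0. Qed.
Let vE0 v : v != 0 -> veronese 2 v *m E != 0.
Proof. by move=> v0; apply: mulmx_free_neq0 => //; exact: veronese_neq0. Qed.
Let uMm u : u *m M \in m. Proof. by rewrite -rM mem_rowvs. Qed.

Let conic_on g : g \in G -> exists2 v, v != 0 & veronese 2 v *m E \in g.
Proof.
case/EG => x /rncP[v v0 xv]; rewrite in_points xv -memvE => vg.
by exists v.
Qed.

Let rel_u u : u != 0 -> exists2 v, v != 0 & rel u v.
Proof.
move=> u0; have [g gG ug] := gen_at_m (uM0 u0) (uMm u).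
by have [v v0 vg] := conic_on gG; exists v => //; exists g.
Qed.

Let not_in_E g w : g \in G -> w \in g -> w != 0 -> w \in m -> w \notin rowvs E.
Proof.
move=> gG wg w0 wm; apply: contra w0 => wE.
by rewrite -memv0 -mE0 memv_cap wm.
Qed.

(** A generator contained in the plane of the conic would make this plane meet m. *)
Let E_on_g g w w' : g \in G -> w \in g -> w' \in g -> w \in rowvs E -> w' \in rowvs E ->
  w != 0 -> w' \in <[w]>%VS.
Proof.
move=> gG wg w'g wE w'E w0; apply: contraT => w'w.
have [y [y0 yg ym]] := meet_m gG.
have : (g <= rowvs E)%VS by rewrite -(span2 (gd gG) wg w'g w0 w'w) subv_add -!memvE wE.
by move/subvP/(_ y yg); rewrite (negPf (not_in_E gG yg y0 ym)).
Qed.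

Let rel_v v : v != 0 -> exists2 u, u != 0 & rel u v.
Proof.
move=> v0; have [x xv] := vec_PG (vE0 v0).
have xK : x \in K.
  by apply: (subsetP EK); apply/rncP; exists v.
have [g gG] := point_gen q_ge3 card_K sect mG xK.
rewrite in_points xv -memvE => vg.
have [y [y0 yg]] := meet_m gG; rewrite -rM => /rowvsP[u yu].
exists u; first by apply: contra_neq y0 => u0; rewrite yu u0 mul0mx.
by exists g; rewrite -yu.
Qed.

Let rel_inj_v u v v' : u != 0 -> v != 0 -> v' != 0 -> rel u v -> rel u v' ->
  exists2 c, c != 0 & v' = c *: v.
Proof.
move=> u0 v0 v'0 [g [gG ug vg]] [g' [g'G ug' v'g]].
have e := disj gG g'G (uM0 u0) ug ug'; rewrite -{}e in v'g.
have /vlineP[k] := E_on_g gG vg v'g (mem_rowvs _ _) (mem_rowvs _ _) (vE0 v0).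
by rewrite scalemxAl => /(row_free_inj fE); apply: veronese_inj.
Qed.

Let rel_scale k u v : rel u v -> rel (k *: u) v.
Proof. by case=> g [gG ug vg]; exists g; rewrite -scalemxAl memvZ. Qed.

Let rel_span u v g : u != 0 -> v != 0 -> g \in G -> u *m M \in g ->
  veronese 2 v *m E \in g -> g = (<[u *m M]> + <[veronese 2 v *m E]>)%VS.
Proof.
move=> u0 v0 gG ug vg; rewrite (span2 (gd gG) ug vg) ?uM0 //.
apply: contra (not_in_E gG ug (uM0 u0) (uMm u)) => /vlineP[k e].
have := vE0 v0; rewrite e scaler_eq0 negb_or => /andP[k0 _].
by rewrite -[u *m M](scalerK k0) -e memvZ // mem_rowvs.
Qed.

(** Only one hyperplane through the plane U of g0 and w contains m, and only one contains
    the plane of the conic, namely H. The sum of a point of m off H and a point of that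
    plane off U + m spans with U a third one. *)
Lemma second_hyperplane w : w \in rowvs E -> w \notin g0 ->
  exists H', [/\ \dim H' = 4%N, (g0 <= H')%VS, w \in H', ~~ (m <= H')%VS & ~~ (rowvs E <= H')%VS].
Proof.
move=> wE wg0; pose U := (g0 + <[w]>)%VS.
have wH : w \in H by apply: (subvP EH).
have UH : (U <= H)%VS by rewrite subv_add g0H -memvE.
have addline (W : vs) x : x \notin W -> \dim (W + <[x]>)%VS = (\dim W).+1.
  move=> xW; have [p px] : exists p : PG F 4, val p = <[x]>%VS.
    by apply: vec_PG; apply: contraNneq xW => ->; exact: mem0v.
  by rewrite -px dim_add_point // in_points px -memvE.
have dU : \dim U = 3%N by rewrite addline // gd.
have [t [t0 tg tm]] := meet_m g0G.
have tE := not_in_E g0G tg t0 tm.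
have HE : H = (g0 + rowvs E)%VS.
  apply/esym/eqP; rewrite eqEdim subv_add g0H EH dH /=.
  have : \dim (rowvs E + <[t]>)%VS = 4%N by rewrite addline ?dim_rowvs.
  move=> d4; apply: (@leq_trans (\dim (rowvs E + <[t]>)%VS)); first by rewrite d4.
  by apply: dimvS; rewrite addvC addvS // -memvE.
have [x xm xH] := subvPn mH.
have dUm : \dim (U + m)%VS = 4%N.
  apply/eqP; rewrite eqn_leq; apply/andP; split.
    have := dimv_sum_cap U m; rewrite dU dm.
    have : (0 < \dim (U :&: m)%VS)%N.
      rewrite lt0n dimv_eq0; apply: contraNneq t0 => U0.
      rewrite -memv0 -U0 memv_cap tm andbT.
      by apply: (subvP (addvSl g0 <[w]>)).
    by move: (\dim _) (\dim _) => a b; clear; lia.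
  apply: (@leq_trans (\dim (U + <[x]>)%VS)).
    by rewrite addline ?dU //; apply: contra xH; apply: (subvP UH).
  by apply: dimvS; rewrite addvS // -memvE.
have EUm : ~~ (rowvs E <= U + m)%VS.
  apply: contra mH => EUm.
  suff -> : H = (U + m)%VS by exact: addvSr.
  apply/eqP; rewrite eqEdim dH dUm leqnn andbT HE subv_add EUm andbT.
  by apply: subv_trans (addvSl _ _); exact: addvSl.
have [y yE yUm] := subvPn EUm.
have yH : y \in H by apply: (subvP EH).
pose z := x + y.
have zH : z \notin H.
  by apply: contra xH => zH; rewrite -[x](addrK y) memvB.
have dH' : \dim (U + <[z]>)%VS = 4%N.
  by rewrite addline ?dU //; apply: contra zH; apply: (subvP UH).
have zH' : z \in (U + <[z]>)%VS by rewrite memvE addvSr.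
have UH' : (U <= U + <[z]>)%VS by exact: addvSl.
exists (U + <[z]>)%VS; split=> //.
- by apply: subv_trans UH'; exact: addvSl.
- by apply: (subvP UH'); rewrite memvE addvSr.
- apply: contra yUm => mH'.
  have e : (U + m)%VS = (U + <[z]>)%VS.
    by apply/eqP; rewrite eqEdim dH' dUm leqnn andbT subv_add UH'.
  have -> : y = z - x by rewrite /z addrC addKr.
  by rewrite memvB // e // (subvP mH').
apply: contra zH => EH'.
suff -> : H = (U + <[z]>)%VS by [].
apply/eqP; rewrite eqEdim dH dH' leqnn andbT HE subv_add EH' andbT.
by apply: subv_trans UH'; exact: addvSl.
Qed.

Section SecondConic.
Variables (E' : 'M[F]_(3, 5)) (v1 : 'rV[F]_2).
Hypotheses (fE' : row_free E') (mE'0 : (m :&: rowvs E' = 0)%VS).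
Hypothesis E'G : forall g, g \in G -> exists2 x, x \in rnc E' & x \in points_of g.
Hypotheses (v10 : v1 != 0) (v1E' : veronese 2 v1 *m E \in rowvs E').
Hypothesis EE' : ~~ (rowvs E <= rowvs E')%VS.

Let decomp (x x' : 'rV_2) (y y' : 'rV_3) :
  x *m M + y *m E = x' *m M + y' *m E -> x = x' /\ y = y'.
Proof. by apply: complementary_decomp; rewrite ?rM. Qed.

(** The plane of E' is a complement of m, so it is the graph over the plane of E of a
    linear map into m. *)
Lemma graph_map : exists L : 'M[F]_(3, 2), forall w,
  w \in rowvs E' <-> exists y, w = (y *m L) *m M + y *m E.
Proof.
have fB : frame M E \in unitmx by apply: frame_unit; rewrite ?rM.
pose C := E' *m invmx (frame M E) : 'M_(3, 2 + 3).
pose X := lsubmx C; pose Y := rsubmx C.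
have E'E : E' = X *m M + Y *m E.
  have -> : X *m M + Y *m E = row_mx X Y *m frame M E by apply/esym; exact: mul_row_col.
  by rewrite hsubmxK /C mulmxKV.
have fY : Y \in unitmx.
  rewrite -row_free_unit; apply: inj_row_free => y yY.
  have : y *m E' \in (m :&: rowvs E')%VS.
    by rewrite memv_cap mem_rowvs andbT E'E mulmxDr !mulmxA yY mul0mx addr0 uMm.
  by rewrite mE'0 memv0 => /eqP yE'; apply: (row_free_inj fE'); rewrite yE' mul0mx.
exists (invmx Y *m X) => w; split=> [/rowvsP|] [y ->].
  by exists (y *m Y); rewrite E'E mulmxDr !mulmxA mulmxK.
by apply/rowvsP; exists (y *m invmx Y); rewrite E'E mulmxDr !mulmxA mulmxKV.
Qed.

(** The point of the second conic on the generator joining u and v shows that the map L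
    takes the point v of the first conic into the line of u. At v1 the point of the first
    conic lies in the second plane, so L vanishes there, and dividing the quadratic forms
    of L by their common factor leaves a linear map D that takes v to u for all v other
    than v1. As the correspondence is bijective, D is invertible and takes v1 to the
    parameter of the remaining point of the directrix. *)
Lemma correspondence : exists2 D : 'M[F]_2, D \in unitmx &
  forall u v, u != 0 -> v != 0 -> rel u v -> v *m D \in <[u]>%VS.
Proof.
have [L LP] := graph_map.
have Lu u v : u != 0 -> v != 0 -> rel u v -> veronese 2 v *m L \in <[u]>%VS.
  move=> u0 v0 [g [gG ug vg]]; have [x xE' xg] := E'G gG.
  have [w w0 xw] := PG_vec x.
  have : x \in points_of (rowvs E') by apply: (subsetP (rnc_sub fE')).
  move: xg; rewrite !in_points xw -!memvE (rel_span u0 v0 gG ug vg).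
  case/memv_addP => _ /vlineP[a ->] [_ /vlineP[b ->] wab] /LP[y wy].
  move: wab; rewrite wy !scalemxAl => /decomp[yL yb].
  have b0 : b != 0.
    by apply: contraNneq w0 => b0; rewrite wy yL yb b0 !scale0r !mul0mx addr0 -yL yb b0 scale0r !mul0mx.
  apply/vlineP; exists (b^-1 * a).
  by rewrite -scalerA -yL yb -scalemxAl scalerA mulVf ?scale1r.
have v1L : veronese 2 v1 *m L = 0.
  have /LP[y ey] := v1E'; have [] := @decomp 0 (y *m L) (veronese 2 v1) y.
    by rewrite mul0mx add0r.
  by move=> -> ->.
have [D LD] := quadratic_factor v10 v1L.
have nz v : v \notin <[v1]>%VS -> v1 0 1 * v 0 0 - v1 0 0 * v 0 1 != 0.
  by apply: contra => /eqP/(det_vanish v10).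
have Du u v : u != 0 -> v \notin <[v1]>%VS -> rel u v -> v *m D \in <[u]>%VS.
  move=> u0 vv1 r; have v0 : v != 0 by apply: contraNneq vv1 => ->; exact: mem0v.
  by have := Lu u v u0 v0 r; rewrite LD => h; rewrite -[v *m D](scalerK (nz v vv1)) memvZ.
have D0 : D != 0.
  apply: contraNneq EE' => D0; apply/subvP => _ /rowvsP[y ->]; apply/LP; exists y.
  suff -> : L = 0 by rewrite mulmx0 mul0mx add0r.
  have z v j : (veronese 2 v *m L) 0 j = 0 by rewrite LD D0 mulmx0 scaler0 mxE.
  apply/matrixP => i j; rewrite [RHS]mxE.
  have := z (row2 1 1) j; have := z (row2 1 0) j; have := z (row2 0 1) j.
  rewrite !mxE !sum3 !veronese2E !mxE /= !expr1n !expr0n /= !mul1r !mul0r !add0r !addr0.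
  move=> L2 L0; rewrite L0 L2 add0r addr0 => L1.
  case: i => [[|[|[|i]]] il] //; [move: L0|move: L1|move: L2] => <-; congr (L _ j); exact: val_inj.
have fD : D \in unitmx.
  rewrite -row_free_unit; apply: contraT; rewrite -kermx_eq0 => /rowV0Pn[v2 /sub_kermxP v2D v20].
  have [c1 [o1 [c10 v1o]]] := par_repr v10; have [c2 [o2 [c20 v2o]]] := par_repr v20.
  have : (1 < #|~: [set o1; o2]|)%N.
    have := cardsC [set o1; o2]; rewrite card_option => h.
    have : (#|[set o1; o2]| <= 2)%N by rewrite cards2; case: (_ != _).
    by move: h q_ge3; move: #|F| #|_| #|_| => a b c; clear; lia.
  case/card_gt1P => o3 [o4 [o3n o4n o34]].
  (* by Cramer's rule v is a combination of par o and of v2, which D kills *)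
  have nD o v : o != o2 -> exists k, v *m D = k *: (par o *m D).
    move=> oo2; pose dt (a b : 'rV[F]_2) := a 0 1 * b 0 0 - a 0 0 * b 0 1.
    have dt0 : dt v2 (par o) != 0.
      apply: contra oo2 => /eqP/(det_vanish v20)/vlineP[k].
      by rewrite v2o scalerA => /par_inj ->.
    have vE : dt v2 (par o) *: v = dt v (par o) *: v2 + dt v2 v *: par o.
      apply/rowP => i; rewrite /dt !mxE.
      have [->|i0] := eqVneq i 0; first by ring.
      have -> : i = 1 by apply: val_inj; case: i i0 => [[|[|i]] il].
      by ring.
    exists ((dt v2 (par o))^-1 * dt v2 v).
    have : dt v2 (par o) *: (v *m D) = dt v2 v *: (par o *m D).
      by rewrite scalemxAl vE mulmxDl -!scalemxAl v2D scaler0 add0r.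
    by move=> e; rewrite -scalerA -e scalerK.
  have good o : o \in ~: [set o1; o2] -> [/\ o != o2, par o \notin <[v1]>%VS & par o *m D != 0].
    rewrite !inE negb_or => /andP[oo1 oo2]; split=> //.
      by apply: contra oo1 => /vlineP[k]; rewrite v1o scalerA => /par_inj ->.
    apply: contra D0 => /eqP oD; apply/eqP/row_matrixP => i.
    by rewrite rowE row0; have [k ->] := nD o (delta_mx 0 i) oo2; rewrite oD scaler0.
  have [n32 n3 D3] := good _ o3n; have [_ n4 D4] := good _ o4n.
  have [u3 u30 r3] := rel_v (par_neq0 o3); have [u4 u40 r4] := rel_v (par_neq0 o4).
  have /vlineP[a3 e3] := Du _ _ u30 n3 r3; have /vlineP[a4 e4] := Du _ _ u40 n4 r4.
  (* D takes the distinct points o3 and o4 to the same point of the directrix *)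
  have [k ek] := nD o3 (par o4) n32.
  have a40 : a4 != 0 by apply: contraNneq D4 => a40; rewrite e4 a40 scale0r.
  have u43 : u4 = (a4^-1 * (k * a3)) *: u3.
    by rewrite -2!scalerA -e3 -ek e4 scalerK.
  have r43 : rel u4 (par o3) by rewrite u43; apply: rel_scale.
  have [c c0 /par_inj o43] := rel_inj_v u40 (par_neq0 o3) (par_neq0 o4) r43 r4.
  by rewrite o43 eqxx in o34.
exists D => // u v u0 v0 r.
have [vv1|] := boolP (v \in <[v1]>%VS); last by move=> vv1; apply: Du.
have uD0 : u *m invmx D != 0.
  by apply: contra_neq u0 => h; rewrite -[u](mulmxKV fD) h mul0mx.
have [/vlineP[k uk]|uv1] := boolP (u *m invmx D \in <[v1]>%VS).
  have /vlineP[l ->] := vv1; have k0 : k != 0.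
    by apply: contraNneq uD0 => k0; rewrite uk k0 scale0r.
  rewrite -scalemxAl -[v1](scalerK k0) -uk -scalemxAl mulmxKV //.
  by rewrite !memvZ ?memv_line.
have [u' u'0 r'] := rel_v uD0.
have := Du _ _ u'0 uv1 r'; rewrite mulmxKV // => /vlineP[k uk].
have r2 : rel u (u *m invmx D) by rewrite {1}uk; apply: rel_scale.
have [c _ vc] := rel_inj_v u0 v0 uD0 r r2.
by case/negP: uv1; rewrite vc memvZ.
Qed.

End SecondConic.

Lemma scroll_of_correspondence D : D \in unitmx ->
  (forall u v, u != 0 -> v != 0 -> rel u v -> v *m D \in <[u]>%VS) ->
  K = scroll (frame M E) (invmx D).
Proof.
move=> fD corr; apply/setP => p; rewrite inE.
have uD0 u : u != 0 -> u *m invmx D != 0.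
  by apply: contra_neq => h; rewrite -[u](mulmxKV fD) h mul0mx.
have corrV u v : u != 0 -> v != 0 -> rel u v -> exists2 c, c != 0 & v = c *: (u *m invmx D).
  move=> u0 v0 /(corr u v u0 v0)/vlineP[c e]; exists c.
    by apply: contraNneq v0 => c0; rewrite -[v](mulmxK fD) e c0 scale0r mul0mx.
  by rewrite -[LHS](mulmxK fD) e scalemxAl.
apply/idP/existsP => [pK|[u /andP[u0]]].
  have [g gG] := point_gen q_ge3 card_K sect mG pK; rewrite in_points => pg.
  have [y [y0 yg]] := meet_m gG; rewrite -rM => /rowvsP[u yu].
  have u0 : u != 0 by apply: contra_neq y0 => u0; rewrite yu u0 mul0mx.
  rewrite yu in yg; have [v v0 vg] := conic_on gG; exists u; rewrite u0.
  have [c c0 vE] := corrV u v u0 v0 (ex_intro _ g (And3 gG yg vg)).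
  rewrite line_vec_frame conic_vec_frame (subv_trans pg) //.
  by rewrite (rel_span u0 v0 gG yg vg) vE veroneseZ -scalemxAl vline_scale // expf_neq0.
rewrite line_vec_frame conic_vec_frame; have [v v0 [g [gG ug vg]]] := rel_u u0.
have [c c0 vE] := corrV u v u0 v0 (ex_intro _ g (And3 gG ug vg)).
have -> : <[veronese 2 (u *m invmx D) *m E]>%VS = <[veronese 2 v *m E]>%VS.
  by rewrite vE veroneseZ -scalemxAl vline_scale // expf_neq0.
by rewrite -(rel_span u0 v0 gG ug vg) -in_points; apply: kline_sub; apply: gk.
Qed.

Lemma ruled_of_scroll s : s \in unitmx -> K = scroll (frame M E) s -> ruled_cubic_surface K.
Proof.
move=> fs KE; exists (points_of m), (rnc E), (rowvs E); split.
- by exists m.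
- exact: conic_of_rnc.
- by rewrite points_ofI mE0 points_of0.
exists (frame M E), s; split; [by apply: frame_unit; rewrite ?rM|exact: fs| | |exact: KE].
  rewrite -rM (points_of_line fM); apply: eq_param => u.
  by rewrite line_vec_frame veronese1.
by apply: eq_param => u; rewrite conic_vec_frame.
Qed.

End Frame.

Lemma ruled_of_directrix : ruled_cubic_surface K.
Proof.
have cG : #|G| = q.+1 by case: mG.
have [g0 [g1 [g0G g1G g01]]] : exists g0 g1, [/\ g0 \in G, g1 \in G & g0 != g1].
  by apply/card_gt1P; rewrite cG; apply: leq_trans (leq_trans _ q_ge3) (leqnSn _).
have [H [dH g0H mH]] : exists H, [/\ \dim H = 4%N, (g0 <= H)%VS & ~~ (m <= H)%VS].
  have : ~~ (points_of m \subset points_of g0).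
    rewrite points_of_subset; apply: contra (gen_neq mG g0G) => mg.
    by rewrite eq_sym eqEdim mg dm gd.
  case/subsetPn => p pm /hyperplane_avoid[H [dH g0H pH]]; exists H; split=> //.
  by apply: contra pH => /points_ofS/subsetP/(_ p pm).
have [E [fE EH HE EG mE0]] := conic_section q_ge3 card_K sect mG dH g0G g0H mH.
have EK (E1 : 'M[F]_(3, 5)) H1 : points_of H1 :&: K = points_of g0 :|: rnc E1 -> rnc E1 \subset K.
  by move=> e; apply: subset_trans (subsetUr (points_of g0) _) _; rewrite -e subsetIr.
have [M fM rM] := rowvs_basis dm.
have [x /rncP[v1 v10 xv1]] := EG g1 g1G; rewrite in_points xv1 -memvE => v1g1.
have v1E0 : veronese 2 v1 *m E != 0 by apply: mulmx_free_neq0 => //; exact: veronese_neq0.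
have v1g0 : veronese 2 v1 *m E \notin g0.
  by apply: contra g01 => v1g0; rewrite (disj g0G g1G v1E0).
have [H' [dH' g0H' v1H' mH' EH']] :=
  second_hyperplane fE dH g0G g0H mH EH mE0 (mem_rowvs E _) v1g0.
have [E' [fE' E'H' HE' E'G mE'0]] := conic_section q_ge3 card_K sect mG dH' g0G g0H' mH'.
have EE' : ~~ (rowvs E <= rowvs E')%VS by apply: contra EH' => /subv_trans; apply.
have v1E' : veronese 2 v1 *m E \in rowvs E'.
  rewrite memvE -xv1 -in_points; apply: (subsetP (rnc_sub fE')).
  have : x \in points_of H' :&: K.
    rewrite in_setI in_points xv1 -memvE v1H' (subsetP (EK _ _ HE)) //.
    by apply/rncP; exists v1.
  by rewrite HE' in_setU in_points xv1 -memvE (negPf v1g0).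
have [D fD corr] := correspondence fM rM fE mE0 (EK _ _ HE) fE' mE'0 E'G v10 v1E' EE'.
apply: (ruled_of_scroll fM rM fE mE0 (s := invmx D)); first by rewrite unitmx_inv.
exact: (scroll_of_correspondence fM rM fE mE0 EG fD corr).
Qed.

End Scroll.

Lemma ruled_of_sections (F : finFieldType) (K : {set PG F 4}) :
  3 <= #|F| -> #|K| = #|F|.+1 * #|F|.+1 ->
  (forall H : {vspace 'rV[F]_5}, \dim H = 4 ->
     section_spec (points_of H :&: K) (klines K H)) ->
  ruled_cubic_surface K.
Proof.
move=> q_ge3 card_K sect; have [m [G mG]] := exists_directrix q_ge3 card_K sect.
exact: ruled_of_directrix q_ge3 card_K sect m G mG.
Qed.

(** * Hyperplane sections of a scroll *)

Section ScrollSections.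
Variable F : finFieldType.
Local Notation vs := {vspace 'rV[F]_5}.
Local Open Scope ring_scope.
Implicit Types (u v : 'rV[F]_2) (p : PG F 4) (w : 'rV[F]_5).

Lemma hyperplane_form (H : vs) : \dim H = 4%N ->
  exists2 phi : 'cV[F]_5, phi != 0 & forall w, (w \in H) = (w *m phi == 0).
Proof.
move=> dH; have : ~~ (fullv <= H)%VS by apply/negP => /dimvS; rewrite dim_ambient dH.
case/subvPn => w0 _ /linear_form_separating[phi [phiH phi0]].
exists phi; first by apply: contraNneq phi0 => ->; rewrite mulmx0.
move=> w; apply/idP/eqP => [/phiH//|wphi]; apply: contraT => wH.
case/negP: phi0; apply/eqP.
have [p pw] : exists p : PG F 4, val p = <[w]>%VS.
  by apply: vec_PG; apply: contraNneq wH => ->; exact: mem0v.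
have /eqP full : (H + val p == fullv)%VS.
  by rewrite eqEdim subvf dim_ambient dim_add_point ?dH // in_points pw -memvE.
have : w0 \in (H + val p)%VS by rewrite full memvf.
rewrite pw => /memv_addP[h hH [_ /vlineP[k ->] ->]].
by rewrite mulmxDl phiH // -scalemxAl wphi scaler0 addr0.
Qed.

Variables (M : 'M[F]_(2, 5)) (E : 'M[F]_(3, 5)).
Hypotheses (fM : row_free M) (fE : row_free E) (ME0 : (rowvs M :&: rowvs E = 0)%VS).

Let decomp (x x' : 'rV_2) (y y' : 'rV_3) :
  x *m M + y *m E = x' *m M + y' *m E -> x = x' /\ y = y'.
Proof. exact: complementary_decomp. Qed.

Definition ruling v : vs := (<[v *m M]> + <[veronese 2 v *m E]>)%VS.

Lemma rulingZ k v : k != 0 -> ruling (k *: v) = ruling v.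
Proof. by move=> k0; rewrite /ruling veroneseZ -!scalemxAl !vline_scale // expf_neq0. Qed.

Lemma mem_ruling w v : w \in ruling v ->
  exists a b, w = (a *: v) *m M + (b *: veronese 2 v) *m E.
Proof.
case/memv_addP => _ /vlineP[a ->] [_ /vlineP[b ->] ->].
by exists a, b; rewrite !scalemxAl.
Qed.

Lemma in_ruling a b v : (a *: v) *m M + (b *: veronese 2 v) *m E \in ruling v.
Proof. by rewrite -!scalemxAl memv_add // memvZ ?memv_line. Qed.

Lemma dim_ruling v : v != 0 -> \dim (ruling v) = 2%N.
Proof.
move=> v0; have e0 : veronese 2 v *m E != 0 by rewrite mulmx_free_neq0 ?veronese_neq0.
have [p pe] := vec_PG e0; rewrite /ruling -pe dim_add_point ?dim_vline ?mulmx_free_neq0 //.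
rewrite in_points pe -memvE; apply: contra e0 => /vlineP[k ek].
rewrite -memv0 -ME0 memv_cap mem_rowvs andbT ek memvZ ?mem_rowvs //.
Qed.

Lemma ruling_inj v v' : v != 0 -> v' != 0 -> ruling v = ruling v' -> v' \in <[v]>%VS.
Proof.
move=> v0 v'0 e; have := @in_ruling 1 0 v'; rewrite -e => /mem_ruling[a [b /decomp[]]].
by rewrite scale1r => -> _; rewrite memvZ ?memv_line.
Qed.

Lemma ruling_neq_m v : v != 0 -> ruling v != rowvs M.
Proof.
move=> v0; apply: contra_neq (mulmx_free_neq0 fE (veronese_neq0 2 v0)) => e.
apply/eqP; rewrite -memv0 -ME0 memv_cap mem_rowvs andbT -e.
have := @in_ruling 0 1 v; rewrite !scale0r !scale1r mul0mx add0r; exact.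
Qed.

Variable K : {set PG F 4}.
Hypothesis KE : forall p, (p \in K) = [exists v, (v != 0) && (val p <= ruling v)%VS].

Variables (H : vs) (phi : 'cV[F]_5).
Hypotheses (dH : \dim H = 4%N) (phi0 : phi != 0).
Hypothesis HP : forall w, (w \in H) = (w *m phi == 0).
Let X := points_of H :&: K.
Let a := M *m phi.
Let b := E *m phi.
Let L v := (v *m a) 0 0.
Let Q v := (veronese 2 v *m b) 0 0.

Let formE c d v : ((c *: v) *m M + (d *: veronese 2 v) *m E \in H) = (c * L v + d * Q v == 0).
Proof.
rewrite HP; set A := _ *m phi.
have <- : A 0 0 = c * L v + d * Q v.
  by rewrite /A mulmxDl -!mulmxA -!scalemxAl [LHS]mxE [X in X + _]mxE [X in _ + X]mxE.
apply/eqP/eqP => [->|A0]; first by rewrite mxE.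
by rewrite [A]mx11_scalar A0; apply/matrixP => i j; rewrite !mxE mul0rn.
Qed.

Lemma sectionE p : reflect
  (exists v c d, [/\ v != 0, val p = <[(c *: v) *m M + (d *: veronese 2 v) *m E]>%VS &
     c * L v + d * Q v = 0]) (p \in X).
Proof.
rewrite in_setI KE in_points; apply: (iffP andP) => [[pH /existsP[v /andP[v0 pv]]]|].
  have [w w0 pw] := PG_vec p; move: pH pv; rewrite pw -!memvE => wH /mem_ruling[c [d wE]].
  by exists v, c, d; split; rewrite // -?wE //; apply/eqP; rewrite -formE -wE.
case=> v [c [d [v0 pE /eqP e]]]; rewrite pE -!memvE formE; split=> //.
by apply/existsP; exists v; rewrite v0 -memvE in_ruling.
Qed.

(** When L = 0 the hyperplane contains the directrix, and the rulings in it are those over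
    the at most two zeros of Q. *)
Lemma section_directrix : a = 0 -> is_line X \/ two_lines X \/ three_lines X.
Proof.
move=> a0; have dm : \dim (rowvs M) = 2%N by exact: dim_rowvs.
have b0 : b != 0.
  apply: contraNneq phi0 => b0; rewrite -[phi](mulKmx (frame_unit fM fE ME0)).
  have -> : frame M E *m phi = col_mx a b by exact: (mul_col_mx M E).
  by rewrite a0 b0 col_mx0; apply/eqP; exact: mulmx0.
pose Z := [set o | Q (par o) == 0].
have Z2 : (#|Z| <= 2)%N by exact: binary_form_zeros.
have XE : X = points_of (rowvs M) :|: \bigcup_(o in Z) points_of (ruling (par o)).
  apply/setP => p; apply/sectionE/idP.
    case=> v [c [d [v0 pE e]]]; rewrite in_setU in_points pE -!memvE.
    have L0 : L v = 0 by rewrite /L a0 mulmx0 mxE.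
    move: e; rewrite L0 mulr0 add0r => /eqP; rewrite mulf_eq0 => /orP[/eqP->|Q0].
      by rewrite scale0r mul0mx addr0 mem_rowvs.
    have [k [o [k0 vo]]] := par_repr v0.
    apply/orP; right; apply/bigcupP; exists o.
      rewrite inE; move: Q0; rewrite vo /Q veroneseZ -scalemxAl mxE mulf_eq0.
      by rewrite (negPf (expf_neq0 _ k0)).
    by rewrite in_points pE -memvE -(rulingZ _ k0) -vo in_ruling.
  have [w w0 pw] := PG_vec p; rewrite in_setU => /orP[|/bigcupP[o]].
    rewrite in_points pw -memvE => /rowvsP[v wE]; exists v, 1, 0; split.
    - by apply: contra_neq w0 => v0; rewrite wE v0 mul0mx.
    - by rewrite wE scale1r scale0r mul0mx addr0.
    - by rewrite mul1r mul0r addr0 /L a0 mulmx0 mxE.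
  rewrite inE in_points pw -memvE => /eqP Q0 /mem_ruling[c [d wE]].
  exists (par o), c, d; split; rewrite ?par_neq0 -?wE //.
  by rewrite Q0 /L a0 mulmx0 mxE !mulr0 addr0.
have ml o : points_of (rowvs M) <> points_of (ruling (par o)).
  by move/points_of_inj/esym/eqP; apply/negP/ruling_neq_m/par_neq0.
have lineo o : is_line (points_of (ruling (par o))).
  by exists (ruling (par o)); rewrite // dim_ruling ?par_neq0.
have linem : is_line (points_of (rowvs M)) by exists (rowvs M).
move: Z2 XE; rewrite leq_eqVlt ltnS leq_eqVlt ltnS leqn0.
case/or3P => [/cards2P[o [o' [oo' ->]]]|/cards1P[o ->]|/eqP/cards0_eq->].
- rewrite bigcup_setU !big_set1 setUA => XE; right; right.
  exists (points_of (rowvs M)), (points_of (ruling (par o))), (points_of (ruling (par o'))).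
  split=> //; split=> //; move/points_of_inj/ruling_inj.
  rewrite !par_neq0 => /(_ isT isT)/vlineP[k /par_inj e].
  by rewrite e eqxx in oo'.
- rewrite big_set1 => XE; right; left.
  by exists (points_of (rowvs M)), (points_of (ruling (par o))).
by rewrite big_set0 setU0 => ->; left.
Qed.

Hypothesis a0 : a != 0.
Let v0 := row2 (a 1 0) (- a 0 0).

Let LE v : L v = - (v0 0 1 * v 0 0 - v0 0 0 * v 0 1).
Proof.
have -> : v0 0 0 = a 1 0 by rewrite [LHS]mxE.
have -> : v0 0 1 = - a 0 0 by rewrite [LHS]mxE.
rewrite /L mxE sum2; ring.
Qed.

Let v00 : v0 != 0.
Proof.
apply: contraNneq a0 => e; apply/eqP/matrixP => i j; rewrite ord1 [RHS]mxE.
have := congr1 (fun x : 'rV_2 => x 0 1) e; have := congr1 (fun x : 'rV_2 => x 0 0) e.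
rewrite [LHS]mxE [RHS]mxE /= => a1; rewrite [LHS]mxE [RHS]mxE /= => a2.
move/eqP: a2; rewrite oppr_eq0 => /eqP a2.
have [->//|i0] := eqVneq i 0.
by have -> : i = 1 by apply: val_inj; case: i i0 => [[|[|i]] il].
Qed.

Let L0 v : L v = 0 -> v \in <[v0]>%VS.
Proof. by rewrite LE => /eqP; rewrite oppr_eq0 => /eqP/(det_vanish v00). Qed.

Let Lv0 : L v0 = 0.
Proof. by rewrite LE; ring. Qed.

(** Here Q = L l for a linear form l, so that off the ruling over v0 the equation reads
    c = - d l(v), and the residual points have coordinates l(v) v and - veronese 2 v: they form a conic. *)
Let section_conic : Q v0 = 0 -> line_and_conic X.
Proof.
move=> Q0; have v0b : veronese 2 v0 *m b = 0.
  by rewrite [LHS]mx11_scalar -/(Q v0) Q0; apply/matrixP => i j; rewrite !mxE mul0rn.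
have [D DE] := quadratic_factor v00 v0b.
pose l v := - (v *m D) 0 0.
have QL v : Q v = L v * l v by rewrite /Q DE mxE LE /l; ring.
pose N : 'M[F]_(3, 2) := - \matrix_(i, j)
  (if j == 0 then [:: D 0 0; D 1 0; 0]`_i else [:: 0; D 0 0; D 1 0]`_i).
have NE v : veronese 2 v *m N = l v *: v.
  have lE : l v = - (v 0 0 * D 0 0 + v 0 1 * D 1 0).
    by rewrite /l mxE sum2.
  apply/rowP => j; rewrite mxE sum3 !veronese2E lE !mxE /=.
  have [->|j0] := eqVneq j 0; first by rewrite /=; ring.
  have -> : j = 1 by apply: val_inj; case: j j0 => [[|[|j]] jl].
  by rewrite /=; ring.
pose E1 := N *m M - E.
have fE1 : row_free E1.
  apply: inj_row_free => y; rewrite /E1 mulmxBr mulmxA => e.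
  have {}e : (y *m N) *m M + (- y) *m E = 0 *m M + 0 *m E by rewrite mulNmx e !mul0mx addr0.
  by have [_ /eqP] := decomp e; rewrite oppr_eq0 => /eqP.
have vE1 v : veronese 2 v *m E1 = (l v *: v) *m M + (- 1 *: veronese 2 v) *m E.
  by rewrite /E1 mulmxBr mulmxA NE scaleN1r mulNmx.
exists (points_of (ruling v0)), (rnc E1), (rowvs E1); split.
- by exists (ruling v0) => //; exact: dim_ruling.
- exact: conic_of_rnc.
apply/setP => p; apply/sectionE/idP => [[v [c [d [vn0 pE]]]]|].
  rewrite QL => e; rewrite in_setU.
  have [Lv|Lv] := eqVneq (L v) 0.
    have /vlineP[k vk] := L0 Lv.
    have k0 : k != 0 by apply: contraNneq vn0 => k0; rewrite vk k0 scale0r.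
    by rewrite in_points pE -memvE -(rulingZ v0 k0) -vk in_ruling.
  have cE : c = - d * l v.
    by apply: (mulfI Lv); apply/eqP; rewrite -subr_eq0 -[X in _ == X]e; apply/eqP; ring.
  have dn0 : d != 0.
    have : \dim (val p) = 1%N by exact: dim_point.
    by rewrite pE dim_vline => /eqP; rewrite eqb1; apply: contraNneq => d0;
      rewrite cE d0 oppr0 mul0r !scale0r !mul0mx addr0.
  apply/orP; right; apply/rncP; exists v => //.
  rewrite pE -(@vline_scale _ _ (- d) (veronese 2 v *m E1)) ?oppr_eq0 //; congr <[_]>%VS.
  by rewrite vE1 cE scalerDr !scalemxAl !scalerA mulrN1 opprK.
rewrite in_setU => /orP[|/rncP[v vn0 pE]].
  have [w w0 pw] := PG_vec p; rewrite in_points pw -memvE => /mem_ruling[c [d wE]].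
  by exists v0, c, d; rewrite -wE Lv0 Q0 !mulr0 addr0.
by exists v, (l v), (- 1); rewrite -vE1 QL; split=> //; ring.
Qed.

Let Q2E v : Q v = v 0 0 ^+ 2 * b 0 0 + v 0 0 * v 0 1 * b 1 0 + v 0 1 ^+ 2 * b ord_max 0.
Proof. by rewrite /Q mxE sum3 !veronese2E. Qed.

(** Now L and Q have no common zero, so the section has a single point on the ruling
    over v, with coordinates Q(v) v and - L(v) veronese 2 v. These are cubic forms in v,
    and they span all cubic forms because the resultant Q(v0) of L and Q is not 0. *)
Let section_cubic : Q v0 != 0 -> twisted_cubic X.
Proof.
pose c0 := a 0 0; pose c1 := a 1 0.
pose b0 := b 0 0; pose b1 := b 1 0; pose b2 := b ord_max 0.
have Qv0 : Q v0 = c1 ^+ 2 * b0 - c1 * c0 * b1 + c0 ^+ 2 * b2.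
  have e0 : v0 0 0 = c1 by rewrite [LHS]mxE.
  have e1 : v0 0 1 = - c0 by rewrite [LHS]mxE.
  by rewrite Q2E e0 e1 -/b0 -/b1 -/b2; ring.
move=> Q0; have R0 := Q0; rewrite {}Qv0 in R0.
have Lc v : L v = v 0 0 * c0 + v 0 1 * c1 by rewrite /L mxE sum2.
pose A : 'M[F]_(4, 2) := \matrix_(i, j)
  (if j == 0 then [:: b0; b1; b2; 0]`_i else [:: 0; b0; b1; b2]`_i).
pose B : 'M[F]_(4, 3) := \matrix_(i, j)
  (if j == 0 then [:: c0; c1; 0; 0]`_i
   else if j == 1 then [:: 0; c0; c1; 0]`_i else [:: 0; 0; c0; c1]`_i).
pose i2 : 'I_4 := Ordinal (isT : (2 < 4)%N).
have sum4 (f : 'I_4 -> F) : \sum_i f i = f 0 + f 1 + f i2 + f ord_max.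
  rewrite !big_ord_recl big_ord0 addr0 !addrA.
  by congr (f _ + f _ + f _ + f _); apply: val_inj.
have yA (y : 'rV_4) : (y *m A = row2 (y 0 0 * b0 + y 0 1 * b1 + y 0 i2 * b2)
                                     (y 0 1 * b0 + y 0 i2 * b1 + y 0 ord_max * b2)).
  apply/rowP => j; rewrite !mxE sum4 !mxE /=.
  by case: ifP => _ /=; ring.
have yB (y : 'rV_4) : [/\ (y *m B) 0 0 = y 0 0 * c0 + y 0 1 * c1,
    (y *m B) 0 1 = y 0 1 * c0 + y 0 i2 * c1 & (y *m B) 0 ord_max = y 0 i2 * c0 + y 0 ord_max * c1].
  by split; rewrite mxE sum4 !mxE /=; ring.
pose T := A *m M - B *m E.
have yT (y : 'rV_4) : y *m T = (y *m A) *m M + (- (y *m B)) *m E.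
  by rewrite /T mulmxBr !mulmxA mulNmx.
have fT : row_free T.
  apply: inj_row_free => y; rewrite yT => e.
  have {}e : (y *m A) *m M + (- (y *m B)) *m E = 0 *m M + 0 *m E by rewrite e !mul0mx addr0.
  have [] := decomp e; rewrite yA => /rowP eA /eqP; rewrite oppr_eq0 => /eqP eB.
  have := eA 0; have := eA 1; rewrite !mxE /= => e2 e1.
  have [] := yB y; rewrite eB !mxE => /esym e3 /esym e4 /esym e5.
  (* the resultant is a combination of the forms defining e1, ..., e5 *)
  have y3 : y 0 ord_max = 0.
    apply: (mulIf R0); rewrite mul0r.
    transitivity (c0 ^+ 2 * (y 0 1 * b0 + y 0 i2 * b1 + y 0 ord_max * b2)
      - b0 * (c0 * (y 0 1 * c0 + y 0 i2 * c1) - c1 * (y 0 i2 * c0 + y 0 ord_max * c1))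
      - b1 * c0 * (y 0 i2 * c0 + y 0 ord_max * c1)); first by ring.
    by rewrite e2 e4 e5; ring.
  have y0 : y 0 0 = 0.
    apply: (mulIf R0); rewrite mul0r.
    transitivity (c1 ^+ 2 * (y 0 0 * b0 + y 0 1 * b1 + y 0 i2 * b2)
      - b1 * c1 * (y 0 0 * c0 + y 0 1 * c1)
      + b2 * (c0 * (y 0 0 * c0 + y 0 1 * c1) - c1 * (y 0 1 * c0 + y 0 i2 * c1))); first by ring.
    by rewrite e1 e3 e4; ring.
  rewrite y3 mul0r addr0 in e5; rewrite y0 mul0r add0r in e3.
  have [y1 y2] : y 0 1 = 0 /\ y 0 i2 = 0.
    have [c00|c00] := eqVneq c0 0.
      have c10 : c1 != 0.
        apply: contraNneq a0 => c10; apply/eqP/matrixP => i j; rewrite ord1 [RHS]mxE.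
        have [->//|i0] := eqVneq i 0.
        by have -> : i = 1 by apply: val_inj; case: i i0 => [[|[|i]] il].
      move: e4; rewrite c00 mulr0 add0r => e4.
      by split; apply: (mulIf c10); rewrite mul0r.
    have y2 : y 0 i2 = 0 by apply: (mulIf c00); rewrite mul0r.
    by move: e4; rewrite y2 mul0r addr0 => e4; split=> //; apply: (mulIf c00); rewrite mul0r.
  apply/rowP => j; rewrite [RHS]mxE.
  by case: j => [[|[|[|[|j]]]] jl] //; [move: y0|move: y1|move: y2|move: y3] => <-;
    congr (y 0 _); apply: val_inj.
have v3E v : [/\ veronese 3 v 0 0 = v 0 0 ^+ 3, veronese 3 v 0 1 = v 0 0 ^+ 2 * v 0 1,
    veronese 3 v 0 i2 = v 0 0 * v 0 1 ^+ 2 & veronese 3 v 0 ord_max = v 0 1 ^+ 3].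
  by rewrite !mxE /= !expr0 !mulr1 mul1r.
have vT v : veronese 3 v *m T = (Q v *: v) *m M + (- L v *: veronese 2 v) *m E.
  have [w0 w1 w2 w3] := v3E v; rewrite yT; congr (_ *m M + _ *m E).
    rewrite yA w0 w1 w2 w3 Q2E -/b0 -/b1 -/b2; apply/rowP => j; rewrite !mxE.
    have [->|j0] := eqVneq j 0; first by ring.
    have -> : j = 1 by apply: val_inj; case: j j0 => [[|[|j]] jl].
    by ring.
  rewrite scaleNr Lc; congr (- _); have [] := yB (veronese 3 v); rewrite w0 w1 w2 w3 => e0 e1 e2.
  by apply: row3P; rewrite ?e0 ?e1 ?e2 [RHS]mxE !veronese2E; ring.
exists T => //; apply/setP => p; apply/sectionE/rncP => [[v [c [d [vn0 pE e]]]]|[v vn0 pE]].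
  exists v => //; rewrite pE vT.
  have pn0 : (c *: v) *m M + (d *: veronese 2 v) *m E != 0.
    by have := dim_point p; rewrite pE dim_vline => /eqP; rewrite eqb1.
  suff [k k0 [-> ->]] : exists2 k, k != 0 & c = k * Q v /\ d = k * - L v.
    by rewrite -!scalerA -[(k *: _) *m M]scalemxAl -[(k *: _) *m E]scalemxAl -scalerDr vline_scale.
  have [Lv|Lv] := eqVneq (L v) 0.
    have Qv : Q v != 0.
      have /vlineP[k vk] := L0 Lv.
      have k0 : k != 0 by apply: contraNneq vn0 => k0; rewrite vk k0 scale0r.
      by rewrite vk /Q veroneseZ -scalemxAl mxE mulf_neq0 ?expf_neq0.
    move: e; rewrite Lv mulr0 add0r => /eqP; rewrite mulf_eq0 (negPf Qv) orbF => /eqP d0.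
    exists (c / Q v); last by rewrite divfK // d0 oppr0 mulr0.
    rewrite mulf_neq0 ?invr_eq0 //; apply: contraNneq pn0 => c0'.
    by rewrite c0' d0 !scale0r !mul0mx addr0.
  have cE : c = - d / L v * Q v.
    apply: (mulIf Lv); rewrite mulrAC divfK // -[LHS]addr0 -[in LHS](subrr (d * Q v)) addrA e.
    by rewrite sub0r mulNr.
  exists (- d / L v); last by split=> //; field.
  rewrite mulf_neq0 ?invr_eq0 // oppr_eq0; apply: contraNneq pn0 => d0.
  by rewrite cE d0 oppr0 !mul0r !scale0r !mul0mx addr0.
by exists v, (Q v), (- L v); rewrite -vT; split=> //; ring.
Qed.

Lemma section_nondirectrix : line_and_conic X \/ twisted_cubic X.
Proof.
by have [/section_conic|/section_cubic] := eqVneq (Q v0) 0; [left|right].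
Qed.

End ScrollSections.

Lemma sections_of_ruled (F : finFieldType) (K : {set PG F 4}) (H : {vspace 'rV[F]_5}) :
  ruled_cubic_surface K -> \dim H = 4 ->
  let X := points_of H :&: K in
  is_line X \/ two_lines X \/ three_lines X \/ line_and_conic X \/ twisted_cubic X.
Proof.
case=> _ [_ [_ [_ _ _ [g [s [fg fs _ _ KE]]]]]] dH X.
pose M : 'M[F]_(2, 5) := (invmx s *m usubmx (g : 'M_(2 + 3, 5)))%R.
pose E : 'M[F]_(3, 5) := dsubmx (g : 'M_(2 + 3, 5)).
have gE : g = frame (s *m M)%R E by rewrite /M mulKVmx // /frame vsubmxK.
have rowg (x : 'rV[F]_2) (y : 'rV[F]_3) :
    ((row_mx (x *m invmx s) y : 'rV_5) *m g = x *m M + y *m E)%R.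
  rewrite gE; have -> : (x *m M = x *m invmx s *m (s *m M))%R by rewrite mulmxA mulmxKV.
  exact: (mul_row_col (x *m invmx s) y (s *m M) E)%R.
have inj (x : 'rV[F]_2) (y : 'rV[F]_3) : (x *m M + y *m E = 0 -> x = 0 /\ y = 0)%R.
  rewrite -rowg => e; have : (row_mx (x *m invmx s) y = 0 :> 'rV_(2 + 3))%R.
    by rewrite -[LHS](mulmxK fg) [X in (X *m _)%R]e mul0mx.
  rewrite -(row_mx0 F 1 2 3) => /eq_row_mx[xs y0]; split=> //.
  by rewrite -[x](mulmxKV fs) xs mul0mx.
have fM : row_free M.
  by apply: inj_row_free => x xM; have [] := inj x 0%R; rewrite // xM mul0mx addr0.
have fE : row_free E.
  by apply: inj_row_free => y yE; have [] := inj 0%R y; rewrite // yE mul0mx addr0.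
have ME0 : (rowvs M :&: rowvs E = 0)%VS.
  apply/eqP; rewrite -subv0; apply/subvP => w /memv_capP[/rowvsP[x ->] /rowvsP[y xy]].
  have [|-> _] := inj x (- y)%R; first by rewrite xy mulNmx subrr.
  by rewrite mul0mx mem0v.
have s0 (t : 'M_2) u : (t \in unitmx -> u != 0 -> u *m t != 0 :> 'rV[F]_2)%R.
  by move=> ft; apply: contra_neq => h; rewrite -[u](mulmxK ft) h mul0mx.
have {}KE p : (p \in K) = [exists v, (v != 0%R) && (val p <= ruling M E v)%VS].
  have lE u : (line_vec u *m g = u *m s *m M)%R by rewrite gE line_vec_frame -mulmxA.
  have cE v : (conic_vec v *m g = veronese 2 v *m E)%R by rewrite gE conic_vec_frame.
  rewrite KE inE; apply/existsP/existsP => -[u /andP[u0]]; rewrite ?lE ?cE => pu.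
    by exists (u *m s)%R; rewrite s0.
  exists (u *m invmx s)%R; rewrite s0 ?unitmx_inv // lE cE.
  by have -> : (u *m invmx s *m s = u)%R by rewrite mulmxKV.
have [phi phi0 HP] := hyperplane_form dH.
have [a0|a0] := eqVneq (M *m phi)%R 0%R.
  by have := section_directrix fM fE ME0 KE phi0 HP a0; rewrite -/X; case=> [|[]]; auto.
by have := section_nondirectrix fM fE ME0 KE HP a0; rewrite -/X; case; auto 6.
Qed.

Theorem theorem1 (F : finFieldType) (q : nat) (card_F : #|F| = q)
    (q_ge3 : (3 <= q)%N) (K : {set PG F 4})
    (card_K : #|K| = (q ^ 2 + 2 * q + 1)%N) :
  ruled_cubic_surface K <->
  (forall Pi : {vspace 'rV[F]_5}, \dim Pi = 4 ->
     let X := points_of Pi :&: K in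
     is_line X \/ two_lines X \/ three_lines X \/ line_and_conic X \/
     twisted_cubic X).
Proof.
split=> [ruledK Pi dPi|sect]; first exact: sections_of_ruled.
apply: ruled_of_sections => [||H dH]; first by rewrite card_F.
  by rewrite card_K card_F; clear; nia.
by apply: sectionP (sect H dH); rewrite card_F.
Qed.
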